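(* Let $\Sigma$ be a complete $n$-dimensional smooth manifold, let $V$ be a constant vector field on $\mathbb{R}^N$, and let $F:\Sigma\times\mathbb{R}\rightarrow\mathbb{R}^N$ be a smooth family of immersions (an eternal solution) satisfying $$\frac{d}{ds}F(p,s)=H+V^T,\qquad p\in\Sigma,\ s\in\mathbb{R},$$ where $H$ is the mean curvature vector of $M_s=F(\Sigma,s)$ at $F(p,s)$ and $V^T$ is the tangential part of $V$ along $M_s$ at $F(p,s)$. Assume that the non-increasing (in $s$) one-parameter family of measures $e^{\langle F(p,s)-sV,V\rangle}\,d\mu_s$ on $\Sigma$ converges to finite and positive measures as $s\rightarrow\pm\infty$, i.e. $$0<\lim_{s\rightarrow\infty}e^{\langle F(p,s)-sV,V\rangle}\,d\mu_s\leq\lim_{s\rightarrow-\infty}e^{\langle F(p,s)-sV,V\rangle}\,d\mu_s<\infty .$$ Then there exist sequences $b_k\rightarrow\infty$ and $a_k\rightarrow-\infty$ such that $M_{b_k}$ and $M_{a_k}$ are asymptotic to translating solitons in the following sense: for any relatively compact domain $\widetilde{\Sigma}\subset\Sigma$, writing $\widetilde{M}_s=F(\widetilde{\Sigma},s)$, as $k\to\infty$, $$\int_{\widetilde{M}_{b_k}}|H-V^\perp|^2\,e^{\langle x-b_kV,V\rangle}\,d\mu\rightarrow0,$$ $$\int_{\widetilde{M}_{a_k}}|H-V^\perp|^2\,e^{\langle x-a_kV,V\rangle}\,d\mu\rightarrow0.$$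
   Context: $\langle\cdot,\cdot\rangle$ is the Euclidean metric on $\mathbb{R}^N$ and $\overline{\nabla}$ its Levi-Civita connection. For a family of immersions $F(\cdot,s):\Sigma\to\mathbb{R}^N$ and local coordinates $(x^i)$ on $\Sigma$, put $F_i=dF_s(\partial/\partial x^i)$. The induced metric is $g_{ij}=\langle F_i,F_j\rangle$, the second fundamental form is $A_{ij}=(\overline{\nabla}_{F_i}F_j)^\perp$, and the mean curvature vector is $H=g^{ij}A_{ij}$ (the trace, not the average). The superscripts $T$ and $\perp$ denote the orthogonal projections onto the tangent space and normal space of $M_s$. $d\mu_s$ (or simply $d\mu$ when the time is clear) is the volume element of the induced metric at time $s$, regarded both on $\Sigma$ and on $M_s$. The letter $x=F(p,s)$ denotes the position vector, and integrals over $\widetilde{M}_s$ are understood as integrals over $\widetilde{\Sigma}$ via $F(\cdot,s)$. A translating soliton is a submanifold with $H=V^\perp$ for some constant vector $V$; here ''asymptotic to translating solitons'' means exactly the two displayed limits. Under the flow, the measures $e^{\langle F(p,s)-sV,V\rangle}d\mu_s$ on $\Sigma$ are non-increasing in $s$ (pointwise, in terms of densities in fixed local coordinates). The hypothesis that they converge to finite and positive measures as $s\to\pm\infty$ is understood on relatively compact domains: for every nonempty relatively compact domain $\widetilde{\Sigma}\subset\Sigma$, the limits $\lim_{s\to\pm\infty}\int_{\widetilde{\Sigma}}e^{\langle F(p,s)-sV,V\rangle}d\mu_s$ are positive and finite. The sequences $(a_k)$ and $(b_k)$ do not depend on $\widetilde{\Sigma}$. *)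

(* Defs.v *)
From HB Require Import structures.
From mathcomp Require Import all_boot all_order all_algebra.
From mathcomp Require Import all_classical all_reals all_analysis.

Set Implicit Arguments.
Unset Strict Implicit.
Unset Printing Implicit Defensive.

Import Order.TTheory GRing.Theory Num.Theory.
Import numFieldNormedType.Exports.

Local Open Scope classical_set_scope.
Local Open Scope ring_scope.

(* In finite dimension this is the usual C^k condition on an open set [U]: it
   asks for existence and continuity of the iterated directional derivatives
   up to order [k], in all directions instead of only along a basis. *)
Fixpoint Ck_on (R : realType) (E W : normedModType R) (k : nat) (U : set E)
    (f : E -> W) {struct k} : Prop :=
  (forall x, U x -> {for x, continuous f}) /\
  match k with
  | 0 => True
  | k'.+1 => forall v : E,
      (forall x, U x -> derivable f x v) /\ Ck_on k' U ('D_v f)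
  end.

Definition smooth_on (R : realType) (E W : normedModType R) (U : set E)
    (f : E -> W) : Prop := forall k, Ck_on k U f.

Section lebesgue_cons.
Context {R : realType} {n : nat}.
Notation mR := (measurableTypeR R).
Variable m : {sigma_finite_measure set (n.-tuple mR) -> \bar R}.

Definition tuple_cons (z : mR * n.-tuple mR) : n.+1.-tuple mR :=
  [the n.+1.-tuple mR of z.1 :: z.2].

Lemma measurable_tuple_cons : measurable_fun [set: mR * n.-tuple mR] tuple_cons.
Proof. exact: measurable_cons. Qed.

Definition lebesgue_cons : set (n.+1.-tuple mR) -> \bar R :=
  pushforward (product_measure1 (@lebesgue_measure R) m) tuple_cons.

Let lebesgue_cons0 : lebesgue_cons set0 = 0%E.
Proof. by rewrite /lebesgue_cons /pushforward preimage_set0 measure0. Qed.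

Let lebesgue_cons_ge0 A : (0 <= lebesgue_cons A)%E.
Proof. by rewrite /lebesgue_cons /pushforward measure_ge0. Qed.

Let lebesgue_cons_sigma_additive : semi_sigma_additive lebesgue_cons.
Proof.
move=> B mB tB mUB; rewrite /lebesgue_cons /pushforward preimage_bigcup.
apply: measure_semi_sigma_additive.
- by move=> i; rewrite -[X in measurable X]setTI; exact: measurable_tuple_cons.
- apply/trivIsetP => /= i j _ _ ij; rewrite -preimage_setI.
  by move/trivIsetP : tB => /(_ _ _ _ _ ij) ->//; rewrite preimage_set0.
- rewrite -preimage_bigcup -[X in measurable X]setTI.
  exact: measurable_tuple_cons.
Qed.

HB.instance Definition _ := isMeasure.Build _ _ _ lebesgue_cons
  lebesgue_cons0 lebesgue_cons_ge0 lebesgue_cons_sigma_additive.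

Let lebesgue_cons_sigma_finite : sigma_finite setT lebesgue_cons.
Proof.
have /sigma_finiteP[B [UB ndB fB]] := sigma_finiteT (@lebesgue_measure R).
have /sigma_finiteP[C [UC ndC fC]] := sigma_finiteT m.
pose g (t : n.+1.-tuple mR) : mR * n.-tuple mR := (thead t, [tuple of behead t]).
have Kg z : g (tuple_cons z) = z.
  by case: z => x t; congr pair; rewrite ?theadE//; exact: val_inj.
have mg : measurable_fun setT g.
  apply/measurable_fun_pairP; split; first exact: (measurable_tnth ord0).
  exact: measurable_behead.
exists (fun k => g @^-1` (B k `*` C k)).
  rewrite -preimage_bigcup (_ : \bigcup_k (B k `*` C k) = setT)//.
  rewrite -setXTT UB UC predeqE => -[x t]; split.
    by move=> [i _ [? ?]]; split; exists i.
  move=> [/= [i _ Bx] [k _ Ct]]; exists (maxn i k) => //; split.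
    by move: x Bx; exact/subsetPset/ndB/leq_maxl.
  by move: t Ct; exact/subsetPset/ndC/leq_maxr.
move=> k; have [mB Boo] := fB k; have [mC Coo] := fC k; split.
  by rewrite -[X in measurable X]setTI; apply: mg => //; exact: measurableX.
rewrite /lebesgue_cons /pushforward -comp_preimage.
rewrite (_ : g \o tuple_cons = id); last by apply/funext => z; exact: Kg.
by rewrite preimage_id product_measure1E// lte_mul_pinfty// ge0_fin_numE.
Qed.

HB.instance Definition _ := @Measure_isSigmaFinite.Build _ _ _ lebesgue_cons
  lebesgue_cons_sigma_finite.

End lebesgue_cons.

Fixpoint lebesgue_tuple (R : realType) (n : nat) :
    {sigma_finite_measure set (n.-tuple (measurableTypeR R)) -> \bar R} :=
  match n with
  | 0 => dirac ([tuple] : 0.-tuple (measurableTypeR R))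
  | n'.+1 => lebesgue_cons (lebesgue_tuple R n')
  end.

Section local_geometry.
Context {R : realType} {n N : nat}.

Definition dot (u v : 'rV[R]_N) : R := \sum_(k < N) u 0 k * v 0 k.

(* The library norm `|u| on row vectors is the sup norm, hence this one. *)
Definition enorm (u : 'rV[R]_N) : R := Num.sqrt (dot u u).

Variable f : 'rV[R]_n -> 'rV[R]_N.
Implicit Types (y : 'rV[R]_n) (w : 'rV[R]_N) (i j : 'I_n).

Definition partial i (h : 'rV[R]_n -> 'rV[R]_N) : 'rV[R]_n -> 'rV[R]_N :=
  'D_(delta_mx 0 i) h.

Definition tangent_frame y : 'M[R]_(n, N) := \matrix_(i < n) partial i f y.

Definition induced_metric y : 'M[R]_n :=
  \matrix_(i < n, j < n) dot (partial i f y) (partial j f y).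

(* Projection onto the row space of the frame along its orthogonal complement:
   [w <= kermx (tangent_frame y)^T] means that [w] is orthogonal to every row
   of the frame. *)
Definition tangent_proj y w : 'rV[R]_N :=
  w *m proj_mx <<tangent_frame y>>%MS (kermx (tangent_frame y)^T).

Definition normal_proj y w : 'rV[R]_N := w - tangent_proj y w.

Definition second_fundamental_form i j y : 'rV[R]_N :=
  normal_proj y (partial i (partial j f) y).

Definition local_mean_curvature y : 'rV[R]_N :=
  \sum_(i < n) \sum_(j < n)
    invmx (induced_metric y) i j *: second_fundamental_form i j y.

Definition volume_density y : R := Num.sqrt (\det (induced_metric y)).

End local_geometry.

Record smooth_atlas (R : realType) (n : nat) (Sigma : topologicalType) := {
  chart : Type;
  chart_dom : chart -> set Sigma;
  coord : chart -> Sigma -> 'rV[R]_n;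
  param : chart -> 'rV[R]_n -> Sigma;
  chart_at : Sigma -> chart;
  mem_chart_at : forall p, chart_dom (chart_at p) p;
  chart_dom_open : forall c, open (chart_dom c);
  chart_img_open : forall c, open (coord c @` chart_dom c);
  coordK : forall c p, chart_dom c p -> param c (coord c p) = p;
  coord_cts : forall c p, chart_dom c p -> {for p, continuous (coord c)};
  param_cts : forall c y, (coord c @` chart_dom c) y -> {for y, continuous (param c)};
  transition_smooth : forall c c',
    smooth_on (coord c @` (chart_dom c `&` chart_dom c')) (coord c' \o param c)
}.

Definition chart_img (R : realType) (n : nat) (Sigma : topologicalType)
    (A : smooth_atlas R n Sigma) (c : chart A) : set 'rV[R]_n :=
  coord c @` chart_dom c.

Record smooth_manifold (R : realType) (n : nat) (Sigma : topologicalType) := {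
  manifold_atlas :> smooth_atlas R n Sigma;
  manifold_hausdorff : hausdorff_space Sigma;
  manifold_second_countable : @second_countable Sigma
}.

Definition relatively_compact_domain (Sigma : topologicalType) (D : set Sigma) : Prop :=
  [/\ open D, connected D, D !=set0 & precompact D].

Section immersions.
Context {R : realType} {n N : nat} {Sigma : ptopologicalType}.
Variable M : smooth_manifold R n Sigma.

Definition smooth_family (F : Sigma -> R -> 'rV[R]_N) : Prop :=
  forall c : chart M,
    smooth_on [set z : 'rV[R]_n * R^o | chart_img c z.1]
              (fun z => F (param c z.1) z.2).

Definition smooth_curve (gam : R -> Sigma) : Prop :=
  continuous gam /\
  forall c : chart M,
    smooth_on [set t : R^o | chart_dom c (gam t)] (coord c \o gam).

Variable f : Sigma -> 'rV[R]_N.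

Definition in_chart (c : chart M) : 'rV[R]_n -> 'rV[R]_N := f \o param c.

Definition immersion : Prop :=
  forall (c : chart M) y, chart_img c y -> row_free (tangent_frame (in_chart c) y).

(* The values of the next three operators do not depend on the chart around
   [p]; they are computed in the chart [chart_at M p]. *)
Definition tangent_part (p : Sigma) (w : 'rV[R]_N) : 'rV[R]_N :=
  let c := chart_at M p in tangent_proj (in_chart c) (coord c p) w.

Definition normal_part (p : Sigma) (w : 'rV[R]_N) : 'rV[R]_N :=
  let c := chart_at M p in normal_proj (in_chart c) (coord c p) w.

Definition mean_curvature (p : Sigma) : 'rV[R]_N :=
  let c := chart_at M p in local_mean_curvature (in_chart c) (coord c p).

(* [g(gam', gam') = |d(f o gam)/dt|^2] for the metric [g] induced by [f]. *)
Definition curve_length (gam : R -> Sigma) : \bar R :=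
  (\int[lebesgue_measure]_(t in `[0%R, 1%R]) (enorm (derive1 (f \o gam) t))%:E)%E.

(* Smooth and piecewise C^1 curves give the same infimum; it is +oo between
   points in distinct connected components. *)
Definition induced_dist (p q : Sigma) : \bar R :=
  ereal_inf [set curve_length gam | gam in
    [set gam | [/\ smooth_curve gam, gam 0 = p & gam 1 = q]]].

Definition complete_induced_metric : Prop :=
  forall u : nat -> Sigma,
    (forall e : R, 0 < e -> exists k0 : nat, forall k l : nat,
      (k0 <= k)%N -> (k0 <= l)%N -> (induced_dist (u k) (u l) < e%:E)%E) ->
    exists p, (fun k => induced_dist (u k) p) @ \oo --> 0%E.

(* Borel measure which in each chart is [sqrt (det g)] times the Lebesgue
   measure; these values determine it. *)
Definition is_volume_measure
    (mu : {measure set (g_sigma_algebraType (@open Sigma)) -> \bar R}) : Prop :=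
  forall (c : chart M) (B : set (g_sigma_algebraType (@open Sigma))),
    measurable B -> B `<=` chart_dom c ->
    mu B = (\int[lebesgue_tuple R n]_(t in
              [set t | (coord c @` B) (\row_(i < n) tnth t i)])
              (volume_density (in_chart c) (\row_(i < n) tnth t i))%:E)%E.

End immersions.

(* Main.v *)
(* Put W = dF/ds - V. The flow equation says W = H - V^perp, so W is normal to M_s.
   Differentiating <W, F_j> = 0 gives g^ij <d_i W, F_j> = - <W, H>, and hence the
   density rho = e^<F - sV, V> sqrt(det g) of the weighted measure in a chart
   satisfies d rho/ds = - |W|^2 rho. Thus, for a domain D contained in a chart,
   I_D(s) = int_D rho is nonincreasing and bounded between its two limits, and it
   drops at rate at least e near every time s at which J_D(s) = int_D |W|^2 rho
   exceeds e. So for finitely many domains any sufficiently long time interval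
   contains a time at which all J_D are at most e. Applying this to longer and longer
   initial segments of a countable cover of Sigma by relatively compact chart balls
   yields sequences b_k and a_k that do not depend on the domain; a general
   relatively compact domain is covered by finitely many of the balls. *)

Require Import Defs.
From HB Require Import structures.
From mathcomp Require Import all_boot all_order all_algebra perm.
From mathcomp Require Import all_classical all_reals all_analysis.
From mathcomp Require Import measurable_realfun.
From mathcomp Require Import ring lra.

Set Implicit Arguments.
Unset Strict Implicit.
Unset Printing Implicit Defensive.

Import Order.TTheory GRing.Theory Num.Theory.
Import numFieldNormedType.Exports.

Local Open Scope classical_set_scope.
Local Open Scope ring_scope.

Local Notation coord := Defs.coord.

(** * Calculus in normed modules *)

(** Two obstacles shape the argument. The mean curvature at [p] is computed in the chart
    [chart_at M p], which varies with [p] in no controlled way, so neither its continuity nor the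
    variation formula in a fixed chart can be read off its definition. The flow equation removes
    this: [W] is a time derivative of [F] minus a constant, hence continuous in every chart, while
    normality and volume densities pass between charts through the Jacobian of the transition map.
    Only a one-sided consequence is used: if [J_D(s) > e], then [I_D(s + h) <= I_D(s) - e h] for all
    small [h > 0]. Monotonicity of [I_D] extends this from single times to whole intervals. The
    length of interval that suffices depends on the domains and the tolerance but not on where the
    interval starts, which serves both ends of the time axis. *)

Section line.
Context {R : realType} {E : normedModType R}.

Lemma is_derive_line (W : normedModType R) (f : E -> W) (x v : E) (t : R) (df : W) :
  is_derive (x + t *: v) v f df -> is_derive t 1 (fun r : R => f (x + r *: v)) df.
Proof.
move=> [dfx <-].
have e : (fun h => h^-1 *: (((fun r : R => f (x + r *: v)) \o shift t) (h *: 1)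
      - f (x + t *: v)))
    = (fun h => h^-1 *: ((f \o shift (x + t *: v)) (h *: v) - f (x + t *: v))).
  by apply/funext => h /=; rewrite [h%:A]mulr1 scalerDl addrCA.
by split; rewrite /derivable /derive e.
Qed.

Lemma is_derive_translate (W : normedModType R) (f : E -> W) (x v w : E) (df : W) :
  is_derive (x + w) v f df -> is_derive x v (fun y => f (y + w)) df.
Proof.
move=> [dfx <-].
have e : (fun h => h^-1 *: (((fun y => f (y + w)) \o shift x) (h *: v) - f (x + w)))
    = (fun h => h^-1 *: ((f \o shift (x + w)) (h *: v) - f (x + w))).
  by apply/funext => h /=; rewrite addrA.
by split; rewrite /derivable /derive e.
Qed.

Lemma MVT_line (f df : E -> R) (x v : E) (t : R) : 0 <= t ->
  (forall r, r \in `[0, t] -> is_derive (x + r *: v) v f (df (x + r *: v))) ->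
  exists2 c, c \in `[0, t] & f (x + t *: v) - f x = t * df (x + c *: v).
Proof.
move=> t0 dfE.
have dg r : r \in `[0, t] ->
    is_derive r 1 (fun r : R => f (x + r *: v)) (df (x + r *: v)).
  by move=> /dfE; exact: is_derive_line.
have cg : {within `[0, t], continuous (fun r : R => f (x + r *: v))}.
  by apply: derivable_within_continuous => r /dg[].
have [c cI] := MVT_segment t0 (fun r rI => dg r (subset_itv_oo_cc rI)) cg.
by rewrite scale0r addr0 subr0 mulrC => ->; exists c.
Qed.

Lemma MVT_line_norm (f df : E -> R) (x v : E) (t : R) :
  (forall r, `|r| <= `|t| -> is_derive (x + r *: v) v f (df (x + r *: v))) ->
  exists2 c, `|c| <= `|t| & f (x + t *: v) - f x = t * df (x + c *: v).
Proof.
move=> dfE; have [t0|/ltW t0] := leP 0 t.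
  have [r|c] := @MVT_line f df x v t t0.
    by rewrite in_itv/= => /andP[r0 rt]; apply: dfE; rewrite !ger0_norm.
  by rewrite in_itv/= => /andP[c0 ct] ?; exists c; rewrite // !ger0_norm.
(* For negative [t] the segment is run from its other end [x + t *: v]. *)
have [|r|c] := @MVT_line f df (x + t *: v) v (- t).
- by rewrite oppr_ge0.
- rewrite in_itv/= => /andP[r0 rt]; rewrite -addrA -scalerDl; apply: dfE.
  by rewrite (ler0_norm t0) ler_norml; lra.
rewrite in_itv/= => /andP[c0 ct].
rewrite -!addrA -!scalerDl subrr scale0r addr0 => /eqP e.
exists (t + c); first by rewrite (ler0_norm t0) ler_norml; lra.
by apply/eqP; rewrite -eqr_opp opprB (eqP e) mulNr.
Qed.

Section clairaut.
Variable U : set E.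
Hypothesis oU : open U.

(** The mean value theorem, applied to [y |-> f (y + t *: v) - f y] along [u] and then to [fu] along
    [v], writes the second difference as [t ^+ 2] times the value of [fuv] at a point of a small
    parallelogram at [x]; continuity of [fuv] at [x] concludes. *)
Lemma second_difference (f fu fuv : E -> R) (u v x : E) (e : R) :
  (forall y, U y -> is_derive y u f (fu y)) ->
  (forall y, U y -> is_derive y v fu (fuv y)) ->
  U x -> {for x, continuous fuv} -> 0 < e ->
  \forall t \near 0^'+, `|(f (x + t *: u + t *: v) - f (x + t *: u)
      - f (x + t *: v) + f x) / t ^+ 2 - fuv x| <= e.
Proof.
move=> dfu dfuv Ux cuv e0.
have nU : nbhs x [set y | U y /\ `|fuv x - fuv y| <= e].
  apply: filterI; first exact: open_nbhs_nbhs.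
  by move/cvgrPdist_le : cuv; exact.
have dB : \forall d \near 0^'+, forall a b, `|a| <= d -> `|b| <= d ->
    U (x + a *: u + b *: v) /\ `|fuv x - fuv (x + a *: u + b *: v)| <= e.
  move/nbhs_ballP : nU => [r /= r0 rB].
  near=> d => a b ad bd; apply: (rB (x + a *: u + b *: v)).
  rewrite -ball_normE/= opprD addrA opprD addrA subrr add0r.
  rewrite -opprD normrN (le_lt_trans (ler_normD _ _))//.
  have K0 : 0 < `|u| + `|v| + 1 by rewrite ltr_wpDl// addr_ge0.
  rewrite !normrZ (@le_lt_trans _ _ (d * (`|u| + `|v| + 1)))//.
    rewrite !mulrDr mulr1 ler_wpDr//; last by rewrite lerD// ler_wpM2r.
  rewrite -ltr_pdivlMr//; near: d; apply: nbhs_right_lt.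
  by rewrite divr_gt0.
near=> t.
have t0 : 0 < t by near: t; exact: nbhs_right_gt.
have tB : forall a b, `|a| <= t -> `|b| <= t -> U (x + a *: u + b *: v) /\
    `|fuv x - fuv (x + a *: u + b *: v)| <= e.
  by near: t.
have inU a b : `|a| <= t -> `|b| <= t -> U (x + a *: u + b *: v).
  by move=> at_ bt; have [] := tB a b at_ bt.
pose g y := f (y + t *: v) - f y.
have t0' := ltW t0.
have [a aI|a aI ge] := @MVT_line g (fun y => fu (y + t *: v) - fu y) x u t t0'.
  have /andP[a0 at_] : 0 <= a <= t by move: aI; rewrite in_itv.
  have at' : `|a| <= t by rewrite ger0_norm.
  apply: is_deriveB.
    apply: is_derive_translate; apply: dfu.
    by apply: inU => //; rewrite ger0_norm// ltW.
  apply: dfu.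
  by rewrite -[x + _](addr0) -(scale0r v); apply: inU => //; rewrite normr0.
have /andP[a0 at_] : 0 <= a <= t by move: aI; rewrite in_itv.
have at' : `|a| <= t by rewrite ger0_norm.
have [b bI|b bI fuE] := @MVT_line fu fuv (x + a *: u) v t t0'.
  have /andP[b0 bt] : 0 <= b <= t by move: bI; rewrite in_itv.
  by apply: dfuv; apply: inU => //; rewrite ger0_norm.
have /andP[b0 bt] : 0 <= b <= t by move: bI; rewrite in_itv.
have bt' : `|b| <= t by rewrite ger0_norm.
have [_ Dab] := tB a b at' bt'.
have -> : (f (x + t *: u + t *: v) - f (x + t *: u) - f (x + t *: v) + f x)
    / t ^+ 2 = fuv (x + a *: u + b *: v).
  rewrite -addrA [- _ + f x]addrC -[f x - _]opprB.
  rewrite [X in X / _]ge fuE mulrA -expr2.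
  by rewrite mulrAC divff ?mul1r// expf_neq0// gt_eqF.
by rewrite distrC.
Unshelve. all: by end_near. Qed.

(** The second difference is symmetric in [u] and [v], so one and the same quotient approximates
    both mixed derivatives. *)
Lemma clairaut_real (f fu fv fuv fvu : E -> R) (u v x : E) :
  (forall y, U y -> is_derive y u f (fu y)) ->
  (forall y, U y -> is_derive y v f (fv y)) ->
  (forall y, U y -> is_derive y v fu (fuv y)) ->
  (forall y, U y -> is_derive y u fv (fvu y)) ->
  U x -> {for x, continuous fuv} -> {for x, continuous fvu} -> fuv x = fvu x.
Proof.
move=> dfu dfv dfuv dfvu Ux cuv cvu.
apply/eqP; rewrite -subr_eq0 -normr_le0; apply/ler_addgt0Pl => e e0.
rewrite addr0.
have e20 : 0 < e / 2 by rewrite divr_gt0.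
have P1 := second_difference dfu dfuv Ux cuv e20.
have P2 := second_difference dfv dfvu Ux cvu e20.
near (0:R)^'+ => t.
have Q1 : `|(f (x + t *: u + t *: v) - f (x + t *: u)
      - f (x + t *: v) + f x) / t ^+ 2 - fuv x| <= e / 2 by near: t.
have : `|(f (x + t *: v + t *: u) - f (x + t *: v)
      - f (x + t *: u) + f x) / t ^+ 2 - fvu x| <= e / 2 by near: t.
rewrite [x + _ + t *: u]addrAC [f _ - _ - f _]addrAC => Q2.
move: Q1 Q2; set A := _ / _ => Q1 Q2.
rewrite -(subrKA A) [e]splitr (le_trans (ler_normD _ _))// lerD// distrC.
by [].
Unshelve. all: by end_near. Qed.

End clairaut.

Lemma is_derive_coord m n (f : E -> 'M[R]_(m, n)) (x v : E) (df : 'M[R]_(m, n)) i j :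
  is_derive x v f df -> is_derive x v (fun y => f y i j) (df i j).
Proof.
by move=> [dfx <-]; split; [exact: ((derivable_mxP f x v).1 dfx)|rewrite derive_mx// mxE].
Qed.

Lemma is_derive_mx m n (f : E -> 'M[R]_(m, n)) (x v : E) (df : 'M[R]_(m, n)) :
  (forall i j, is_derive x v (fun y => f y i j) (df i j)) -> is_derive x v f df.
Proof.
move=> dfx; have dx : derivable f x v by apply: ((derivable_mxP f x v).2) => i j; case: (dfx i j).
split=> //; rewrite derive_mx//; apply/matrixP => i j; rewrite mxE.
by case: (dfx i j).
Qed.

Lemma continuous_coord m n (f : E -> 'M[R]_(m, n)) (x : E) i j :
  {for x, continuous f} -> {for x, continuous (fun y => f y i j)}.
Proof.
move=> cf; apply: (@continuous_comp _ _ _ f (fun M : 'M[R]_(m, n) => M i j)) => //.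
exact: coord_continuous.
Qed.

Lemma clairaut N (U : set E) (f : E -> 'rV[R]_N) (u v x : E) :
  open U -> Ck_on 2 U f -> U x -> 'D_v ('D_u f) x = 'D_u ('D_v f) x.
Proof.
move=> oU [_ fU] Ux; apply/rowP => j.
have D1 w y : U y -> is_derive y w (fun y => f y 0 j) ('D_w f y 0 j).
  by move=> Uy; apply: is_derive_coord; apply: derivableP; apply: (fU w).1.
have D2 w w' y : U y ->
    is_derive y w' (fun y => 'D_w f y 0 j) ('D_w' ('D_w f) y 0 j).
  move=> Uy; apply: is_derive_coord; apply: derivableP.
  by have [_ [_ /(_ w')[+ _]]] := fU w; apply.
have C w w' : {for x, continuous (fun y => 'D_w' ('D_w f) y 0 j)}.
  apply: continuous_coord.
  by have [_ [_ /(_ w')[_ [+ _]]]] := fU w; apply.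
exact: (clairaut_real oU (D1 u) (D1 v) (D2 u v) (D2 v u) Ux (C u v) (C v u)).
Qed.

End line.

(** * Differentials of C^1 functions and the chain rule *)

Section C1_differentiable.
Context {R : realType} {n : nat}.
Implicit Types (x y h : 'rV[R]_n).

(** The points [x + truncate k h], for [k] from 0 to [n], are the vertices of a staircase path from
    [x] to [x + h] with edges parallel to the axes. *)
Definition truncate (k : nat) h : 'rV[R]_n := \row_i (h 0 i *+ (i < k)%N).

(** In the sup norm the edges of the staircase stay as close to its start as its end is, so a ball
    around [x] that contains [x + h] contains the whole path. *)
Lemma norm_truncate_le k h (i : 'I_n) (c : R) : k = i -> `|c| <= `|h 0 i| ->
  `|truncate k h + c *: delta_mx 0 i| <= `|h|.
Proof.
move=> ki ch; rewrite [leLHS]/Num.Def.normr/= mx_normrE bigmax_le//= => -[a j] _.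
rewrite ord1 !mxE eqxx/=.
have hj (l : 'I_n) : `|h 0 l| <= `|h|.
  by rewrite [leRHS]/Num.Def.normr/= mx_normrE (le_bigmax _ _ (0, l)).
have [->|ji] := eqVneq j i; rewrite ?mulr1 ?mulr0 ?addr0.
  by rewrite ki ltnn mulr0n add0r (le_trans ch).
by case: (j < k)%N; rewrite ?mulr1n ?mulr0n ?normr0.
Qed.

Lemma truncateS h (i : 'I_n) :
  truncate i.+1 h = truncate i h + h 0 i *: delta_mx 0 i.
Proof.
apply/rowP => j; rewrite !mxE eqxx/= ltnS leq_eqVlt.
have [->|ji] := eqVneq j i; first by rewrite eqxx ltnn mulr1 mulr0n add0r.
by rewrite -val_eqE in ji; rewrite (negbTE ji) mulr0 addr0.
Qed.

(** The increment of [f] telescopes along the staircase; on each edge the mean value theorem yields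
    a partial derivative at a point near [x], which continuity compares with the one at [x]. *)
Lemma C1_differential_bound (f : 'rV[R]_n -> R) (df : 'I_n -> 'rV[R]_n -> R)
    (U : set 'rV[R]_n) x (e : R) : open U -> U x -> 0 < e ->
  (forall y i, U y -> is_derive y (delta_mx 0 i) f (df i y)) ->
  (forall i, {for x, continuous (df i)}) ->
  \forall h \near (0 : 'rV[R]_n), `|f (h + x) - f x - \sum_i h 0 i * df i x| <= e * `|h|.
Proof.
move=> oU Ux e0 dfU cdf.
(* The error is shared among [n] edges; [n + 1] keeps the share meaningful when [n = 0]. *)
have n0 : 0 < n%:R + 1 :> R by rewrite ltr_wpDl.
have nU : nbhs x [set y | U y /\ forall i, `|df i x - df i y| <= e / (n%:R + 1)].
  apply: filterI; first exact: open_nbhs_nbhs.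
  apply: (@filter_forall _ _ (fun i y => `|df i x - df i y| <= e / (n%:R + 1))
    (nbhs x) (nbhs_filter x)) => i.
  move/cvgrPdist_le : (cdf i); apply.
  by rewrite divr_gt0.
move/nbhs_ballP : nU => [r /= r0 rB].
near=> h.
have hr : `|h| < r by near: h; apply: cvgr0_norm_lt.
have step (i : 'I_n) : `|f (x + truncate i.+1 h) - f (x + truncate i h)
    - h 0 i * df i x| <= `|h| * (e / (n%:R + 1)).
  have inB c : `|c| <= `|h 0 i| ->
      ball x r (x + truncate i h + c *: delta_mx 0 i).
    move=> ch; rewrite -ball_normE/= opprD addrA opprD addrA subrr add0r.
    by rewrite -opprD normrN (le_lt_trans _ hr)// norm_truncate_le.
  have [c ch|c ch] := @MVT_line_norm _ _ f (df i) (x + truncate i h) (delta_mx 0 i) (h 0 i).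
    by apply: dfU; exact: (rB _ (inB c ch)).1.
  rewrite truncateS addrA => ->; rewrite -mulrBr normrM ler_pM//.
    by rewrite [leRHS]/Num.Def.normr/= mx_normrE (le_bigmax _ _ (0, i)).
  by rewrite distrC; exact: (rB _ (inB c ch)).2.
have -> : f (h + x) - f x =
    \sum_(i < n) (f (x + truncate i.+1 h) - f (x + truncate i h)).
  rewrite -(big_mkord xpredT
    (fun i => f (x + truncate i.+1 h) - f (x + truncate i h))).
  rewrite telescope_sumr//.
  have -> : truncate n h = h by apply/rowP => i; rewrite mxE ltn_ord mulr1n.
  have -> : truncate 0 h = 0 by apply/rowP => i; rewrite !mxE mulr0n.
  by rewrite addr0 [h + x]addrC.
rewrite -sumrB (le_trans (ler_norm_sum _ _ _))//.
rewrite (@le_trans _ _ (\sum_(i < n) `|h| * (e / (n%:R + 1))))//.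
  by apply: ler_sum => i _; exact: step.
rewrite sumr_const card_ord -[leLHS]mulr_natr -mulrA mulrC ler_wpM2r//.
rewrite -mulrA ler_piMr ?(ltW e0)// mulrC ler_pdivrMr// mul1r ler_wpDr//.
Unshelve. all: by end_near. Qed.

(** [Ck_on] supplies directional derivatives only, whereas the chain rule requires a differential of
    the outer function. *)
Lemma C1_differentiable (f : 'rV[R]_n -> R) (df : 'I_n -> 'rV[R]_n -> R)
    (U : set 'rV[R]_n) x : open U -> U x ->
  (forall y i, U y -> is_derive y (delta_mx 0 i) f (df i y)) ->
  (forall i, {for x, continuous (df i)}) ->
  differentiable f x /\ forall h, 'd f x h = \sum_i h 0 i * df i x.
Proof.
move=> oU Ux dfU cdf.
pose L (h : 'rV[R]_n) : R := \sum_i h 0 i * df i x.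
have linL : linear L.
  move=> a u v; rewrite /L scaler_sumr -big_split/=; apply: eq_bigr => i _.
  by rewrite !mxE mulrDl -mulrA.
pose LM := GRing.isLinear.Build _ _ _ _ _ linL.
pose LL : {linear 'rV[R]_n -> R} := HB.pack L LM.
have cL : continuous LL.
  rewrite -[LL : _ -> _]/(fun h => \sum_(i < n) h 0 i * df i x).
  apply: continuous_big => [|i _ y]; first exact: add_continuous.
  by apply: continuousM; [exact: coord_continuous|exact: cst_continuous].
have fL : forall e : R, 0 < e ->
    \forall h \near (0 : 'rV[R]_n), `|f (h + x) - (f x + LL h)| <= e * `|h|.
  move=> e e0; have := C1_differential_bound oU Ux e0 dfU cdf.
  by apply: filterS => h; rewrite opprD addrA.
have dE : 'd f x = LL :> ('rV[R]_n -> R).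
  by apply: (@diff_unique R 'rV[R]_n R^o) => //; apply/eqaddoP => e; exact: fL.
split; last by move=> h; rewrite dE.
apply/diff_locallyP; rewrite dE; split=> //.
by apply/eqaddoP => e; exact: fL.
Qed.

Lemma derive_comp_C1 (E : normedModType R) (f : 'rV[R]_n -> R) (df : 'I_n -> 'rV[R]_n -> R)
    (U : set 'rV[R]_n) (g : E -> 'rV[R]_n) (z v : E) :
  open U -> U (g z) ->
  (forall y i, U y -> is_derive y (delta_mx 0 i) f (df i y)) ->
  (forall i, {for g z, continuous (df i)}) ->
  derivable g z v ->
  is_derive z v (f \o g) (\sum_i ('D_v g z) 0 i * df i (g z)).
Proof.
move=> oU Ux dfU cdf dg.
have [Df dfE] := C1_differentiable oU Ux dfU cdf.
(* Only a directional derivative of [g] is given; along the line through [z] it becomes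
   differentiability in one variable, to which the chain rule for differentials applies. *)
pose c (t : R) := g (t *: v + z).
have dc : differentiable c 0 by exact: ((derivable1_diffP c 0).1 ((derivable1P g z v).1 dg)).
have c0 : c 0 = g z by rewrite /c scale0r add0r.
have lineE (W : normedModType R) (k : 'rV[R]_n -> W) :
    (fun h : R => h^-1 *: (((k \o c) \o shift 0) (h *: (1:R)) - (k \o c) 0)) =
    (fun h : R => h^-1 *: (((k \o g) \o shift z) (h *: v) - (k \o g) z)).
  by apply/funext => h /=; rewrite c0 /c addr0 [h%:A]mulr1.
have dc0 : 'd c 0 1 = 'D_v g z.
  rewrite -[LHS](@deriveE R R^o 'rV[R]_n c 0 1 dc) /derive.
  by rewrite (lineE _ id).
have Df' : differentiable f (c 0) by rewrite c0.
have dfc : differentiable (f \o c) 0 by exact: differentiable_comp.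
split.
  apply: ((derivable1P (f \o g) z v).2).
  exact: ((derivable1_diffP (f \o c) 0).2 dfc).
rewrite /derive -lineE -[LHS]/('D_1 (f \o c) 0) (@deriveE R R^o R^o (f \o c) 0 1 dfc).
by rewrite (diff_comp dc Df')/= dc0 c0 dfE.
Qed.
End C1_differentiable.

(** * Determinants and orthogonal projections *)

Section determinant_derivative.
Context {R : realType} {E : normedModType R}.

Lemma is_derive_prod n (f : 'I_n -> E -> R) (df : 'I_n -> R) (x v : E) :
  (forall i, is_derive x v (f i) (df i)) ->
  is_derive x v (fun y => \prod_i f i y)
    (\sum_i df i * \prod_(j | j != i) f j x).
Proof.
elim: n f df => [|n IHn] f df dfx.
  rewrite big_ord0 (_ : (fun y => _) = cst 1); first exact: is_derive_cst.
  by apply/funext => y; rewrite big_ord0.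
have -> : (fun y => \prod_i f i y) =
    (f ord0 * (fun y => \prod_(i < n) f (lift ord0 i) y)).
  by apply/funext => y; rewrite big_ord_recl.
have := is_deriveM (dfx ord0) (IHn _ _ (fun i => dfx (lift ord0 i))).
move=> /is_derive_eq; apply.
rewrite big_ord_recl [RHS]addrC; congr (_ + _); last first.
  rewrite [LHS]mulrC; congr (_ * _).
  by rewrite [RHS]big_mkcond big_ord_recl/= mul1r.
rewrite scaler_sumr; apply: eq_bigr => i _.
rewrite -[LHS]/(f ord0 x * (df (lift ord0 i) * _)) mulrCA; congr (_ * _).
by rewrite big_mkcond [RHS]big_mkcond big_ord_recl.
Qed.

Lemma is_derive_sum_fin (I : finType) (f : I -> E -> R) (df : I -> R) (x v : E) :
  (forall i, is_derive x v (f i) (df i)) ->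
  is_derive x v (fun y => \sum_i f i y) (\sum_i df i).
Proof.
move=> dfx; rewrite -big_enum/=.
have -> : (fun y => \sum_i f i y) = (fun y => \sum_(i <- enum I) f i y).
  by apply/funext => y; rewrite big_enum.
elim: (enum I) => [|i r IHr].
  rewrite big_nil (_ : (fun y => _) = cst 0); first exact: is_derive_cst.
  by apply/funext => y; rewrite big_nil.
rewrite big_cons (_ : (fun y => _) = f i + (fun y => \sum_(i <- r) f i y)).
  exact: is_deriveD.
by apply/funext => y; rewrite big_cons.
Qed.

(** Jacobi's formula. [B i] is [A x] with its row [i] replaced by that of [dA]: expanding
    [\det (B i)] along this row gives the trace, and expanding it over permutations gives the
    product rule applied to the determinant. *)
Lemma is_derive_det n (A : E -> 'M[R]_n) (dA : 'M[R]_n) (x v : E) :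
  (forall i j, is_derive x v (fun y => A y i j) (dA i j)) ->
  is_derive x v (fun y => \det (A y)) (\tr (\adj (A x) *m dA)).
Proof.
move=> dAx.
pose B i := \matrix_(k, l) if k == i then dA k l else A x k l.
have -> : \tr (\adj (A x) *m dA) = \sum_i \det (B i).
  rewrite /mxtrace; under eq_bigr do rewrite mxE.
  rewrite exchange_big; apply: eq_bigr => i _ /=.
  rewrite (expand_det_row _ i); apply: eq_bigr => j _.
  rewrite !mxE eqxx mulrC; congr (_ * (_ * \det _)).
  by apply/matrixP => k l; rewrite !mxE eq_sym (negbTE (neq_lift _ _)).
have -> : \sum_i \det (B i) = \sum_(s : 'S_n) (-1) ^+ s *
    \sum_i dA i (s i) * \prod_(j | j != i) A x j (s j).
  rewrite exchange_big; apply: eq_bigr => s _ /=.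
  rewrite mulr_sumr; apply: eq_bigr => i _; congr (_ * _).
  rewrite (bigD1 i)//= !mxE eqxx; congr (_ * _); apply: eq_bigr => j ji.
  by rewrite mxE (negbTE ji).
apply: is_derive_sum_fin => s.
have := is_deriveZ ((-1) ^+ s) (is_derive_prod (fun i => dAx i (s i))).
by [].
Qed.

End determinant_derivative.

Section gram.
Context {R : realType}.
Implicit Types n N : nat.

Lemma dotC N (u w : 'rV[R]_N) : dot u w = dot w u.
Proof. by apply: eq_bigr => i _; rewrite mulrC. Qed.

Lemma dotE N (u w : 'rV[R]_N) : dot u w = (u *m w^T) 0 0.
Proof. by rewrite mxE; apply: eq_bigr => i _; rewrite mxE. Qed.

Lemma dotDl N (u v w : 'rV[R]_N) : dot (u + v) w = dot u w + dot v w.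
Proof. by rewrite !dotE mulmxDl mxE. Qed.

Lemma dotDr N (u v w : 'rV[R]_N) : dot u (v + w) = dot u v + dot u w.
Proof. by rewrite dotC dotDl !(dotC u). Qed.

Lemma dotNr N (u w : 'rV[R]_N) : dot u (- w) = - dot u w.
Proof. by rewrite !dotE linearN mulmxN mxE. Qed.

Lemma dotBr N (u v w : 'rV[R]_N) : dot u (v - w) = dot u v - dot u w.
Proof. by rewrite dotDr dotNr. Qed.

Lemma dotZr N (u w : 'rV[R]_N) a : dot u (a *: w) = a * dot u w.
Proof. by rewrite !dotE linearZ -scalemxAr mxE. Qed.

Lemma dot_sumr N (u : 'rV[R]_N) (I : finType) (w : I -> 'rV[R]_N) :
  dot u (\sum_i w i) = \sum_i dot u (w i).
Proof.
rewrite dotE linear_sum mulmx_sumr summxE.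
by apply: eq_bigr => i _; rewrite dotE.
Qed.

Lemma dot_ge0 N (u : 'rV[R]_N) : 0 <= dot u u.
Proof. by apply: sumr_ge0 => i _; rewrite -expr2 sqr_ge0. Qed.

Lemma dot_eq0 N (u : 'rV[R]_N) : dot u u = 0 -> u = 0.
Proof.
move=> /eqP; rewrite psumr_eq0 => [|i _]; last by rewrite -expr2 sqr_ge0.
move=> /allP u0; apply/rowP => i; rewrite mxE; apply/eqP.
by rewrite -sqrf_eq0 expr2; have /implyP := u0 i (mem_index_enum _); exact.
Qed.

Lemma enorm_sqr N (u : 'rV[R]_N) : enorm u ^+ 2 = dot u u.
Proof. by rewrite /enorm sqr_sqrtr// dot_ge0. Qed.

(** The matrices [A t] join [T *m T^T] to the identity and are positive definite, hence invertible,
    for [t] in [[0, 1]]. Their determinant is continuous, does not vanish and equals 1 at [t = 1],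
    so it cannot be negative or zero at [t = 0]. *)
Lemma gram_det_gt0 n N (T : 'M[R]_(n, N)) : row_free T -> 0 < \det (T *m T^T).
Proof.
move=> Tfree.
pose A (t : R) : 'M[R]_n := t%:M + (1 - t) *: (T *m T^T).
have detA t : 0 <= t <= 1 -> \det (A t) != 0.
  move=> /andP[t0 t1]; rewrite -unitfE -[_ \is a _]/(A t \in unitmx).
  rewrite -[_ \in _]row_free_unit -kermx_eq0; apply/eqP/row_matrixP => i.
  rewrite row0; set u := row i _.
  have uA : u *m A t = 0 by apply/sub_kermxP; exact: row_sub.
  have : t * dot u u + (1 - t) * dot (u *m T) (u *m T) = 0.
    have <- : dot u (u *m A t) = t * dot u u + (1 - t) * dot (u *m T) (u *m T).
      rewrite mulmxDr mul_mx_scalar -scalemxAr dotDr !dotZr; congr (_ + _ * _).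
      by rewrite dotC !dotE trmx_mul !mulmxA.
    by rewrite uA dotC dotE mul0mx mxE.
  have u0 := dot_ge0 u; have uT0 := dot_ge0 (u *m T).
  have [t_eq0|t_neq0] := eqVneq t 0.
    rewrite t_eq0 mul0r add0r subr0 mul1r => /dot_eq0 uT.
    have /row_freeP[B TB] := Tfree.
    by rewrite -[u]mulmx1 -TB mulmxA uT mul0mx.
  move=> /eqP; rewrite paddr_eq0 ?mulr_ge0 ?subr_ge0// => /andP[].
  by rewrite mulf_eq0 (negbTE t_neq0) /= => /eqP /dot_eq0.
have dA (t : R) i j : is_derive t 1 (fun r => A r i j)
    (((1%:M : 'M[R]_n) - T *m T^T) i j).
  pose a : R := 1%:M i j; pose b := (T *m T^T) i j.
  have -> : (1%:M - T *m T^T) i j = a - b by rewrite mxE [X in _ + X]mxE.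
  have -> : (fun r => A r i j) = cst b + ((a - b) *: (id : R -> R)).
    apply/funext => r.
    rewrite -[RHS]/(b + (a - b) * r) /A /a /b mxE [X in _ + X]mxE !mxE.
    by rewrite -mulr_natr; ring.
  have := is_deriveD (is_derive_cst b t 1) (is_deriveZ (a - b) (is_derive_id t 1)).
  by move=> /is_derive_eq; apply; rewrite add0r [LHS]mulr1.
have cA : {within `[0, 1], continuous (fun t => \det (A t))}.
  apply: derivable_within_continuous => t _.
  by have [] := is_derive_det (dA t).
rewrite ltNge; apply/negP => dT.
have [|t] := @IVT R (fun t => \det (A t)) 0 1 0 ler01 cA.
  have -> : A 0 = T *m T^T by rewrite /A subr0 scale1r raddf0 add0r.
  have -> : A 1 = 1%:M by rewrite /A subrr scale0r addr0.
  rewrite det1.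
  by rewrite ge_min dT le_max ler01 orbT.
by rewrite in_itv/= => /detA/negbTE /eqP.
Qed.

End gram.

Section projections.
Context {R : realType} {n N : nat}.
Variables (f : 'rV[R]_n -> 'rV[R]_N) (y : 'rV[R]_n).
Local Notation T := (tangent_frame f y).

Lemma induced_metricE : induced_metric f y = T *m T^T.
Proof.
apply/matrixP => i j; rewrite !mxE; apply: eq_bigr => k _; by rewrite !mxE.
Qed.

(** A vector in both spaces is orthogonal to itself. Together with [frame_add_ker] this makes the
    two spaces complementary, which is what lets [proj_mx] act as the orthogonal projection. *)
Lemma frame_cap_ker : (<<T>> :&: kermx T^T)%MS = 0.
Proof.
apply/eqP/rowV0P => u; rewrite sub_capmx genmxE => /andP[/submxP[a uE] /sub_kermxP u0].
by apply: dot_eq0; rewrite dotE {2}uE trmx_mul mulmxA u0 mul0mx mxE.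
Qed.

Lemma frame_add_ker (w : 'rV[R]_N) : (w <= <<T>> + kermx T^T)%MS.
Proof.
suff : row_full (<<T>> + kermx T^T)%MS by move=> ?; exact: submx_full.
rewrite /row_full (mxrank_disjoint_sum frame_cap_ker) mxrank_gen.
by rewrite mxrank_ker mxrank_tr subnKC// rank_leq_col.
Qed.

Lemma normal_proj_ker w : (normal_proj f y w <= kermx T^T)%MS.
Proof.
rewrite /normal_proj /tangent_proj.
rewrite -{1}(add_proj_mx frame_cap_ker (frame_add_ker w)) addrAC subrr add0r.
exact: proj_mx_sub.
Qed.

Lemma tangent_proj_frame w : (tangent_proj f y w <= T)%MS.
Proof.
have := proj_mx_sub <<T>>%MS (kermx T^T) w.
by rewrite genmxE.
Qed.

Lemma dot_kerP w : (w <= kermx T^T)%MS <->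
  forall i, dot w (partial i f y) = 0.
Proof.
split=> [/sub_kermxP wT i|wT].
  have := congr1 (fun M : 'rV[R]_n => M 0 i) wT; rewrite !mxE => <-.
  by apply: eq_bigr => k _; rewrite !mxE.
apply/sub_kermxP/rowP => i; rewrite !mxE -[RHS](wT i).
by apply: eq_bigr => k _; rewrite !mxE.
Qed.

Lemma dot_normal_proj (u w : 'rV[R]_N) : (u <= kermx T^T)%MS ->
  dot u w = dot u (normal_proj f y w).
Proof.
move=> /sub_kermxP u0; rewrite /normal_proj dotBr.
have /submxP[a ->] := tangent_proj_frame w.
by rewrite [dot u (a *m T)]dotE trmx_mul mulmxA u0 mul0mx mxE subr0.
Qed.

End projections.

(** * First variation of the volume density *)

Section slices.
Context {R : realType} {E W : normedModType R}.
Variable f : E * R^o -> W.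

(** A slice and the joint function have the same difference quotients, so derivability and the value
    of the derivative transfer at once. *)
Let quotient_l (y v : E) (s : R^o) :
  (fun h : R => h^-1 *: (((fun y => f (y, s)) \o shift y) (h *: v) - f (y, s))) =
  (fun h : R => h^-1 *: ((f \o shift (y, s)) (h *: ((v, 0) : E * R^o)) - f (y, s))).
Proof.
apply/funext => h /=; congr (_ *: (f _ - _)).
by rewrite -[RHS]/(h *: v + y, h *: 0 + s) scaler0 add0r.
Qed.

Let quotient_r (y : E) (s : R^o) :
  (fun h : R => h^-1 *: (((fun t => f (y, t)) \o shift s) (h *: (1 : R^o)) - f (y, s))) =
  (fun h : R => h^-1 *: ((f \o shift (y, s)) (h *: ((0, 1) : E * R^o)) - f (y, s))).
Proof.
apply/funext => h /=; congr (_ *: (f _ - _)).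
by rewrite -[RHS]/(h *: 0 + y, h *: 1 + s) scaler0 add0r.
Qed.

Lemma derive_slice_l (y v : E) (s : R^o) :
  'D_v (fun y => f (y, s)) y = 'D_(v, 0) f (y, s).
Proof. by rewrite /derive quotient_l. Qed.

Lemma derivable_slice_l (y v : E) (s : R^o) :
  derivable f (y, s) (v, 0) -> derivable (fun y => f (y, s)) y v.
Proof. by rewrite /derivable -quotient_l. Qed.

Lemma is_derive_slice_l (y v : E) (s : R^o) :
  derivable f (y, s) (v, 0) ->
  is_derive y v (fun y => f (y, s)) ('D_(v, 0) f (y, s)).
Proof. by move=> df; split; [exact: derivable_slice_l|exact: derive_slice_l]. Qed.

Lemma derive_slice_r (y : E) (s : R^o) :
  'D_1 (fun t => f (y, t)) s = 'D_(0, 1) f (y, s).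
Proof. by rewrite /derive quotient_r. Qed.

Lemma derivable_slice_r (y : E) (s : R^o) :
  derivable f (y, s) (0, 1) -> derivable (fun t => f (y, t)) s 1.
Proof. by rewrite /derivable -quotient_r. Qed.

Lemma is_derive_slice_r (y : E) (s : R^o) :
  derivable f (y, s) (0, 1) ->
  is_derive s 1 (fun t => f (y, t)) ('D_(0, 1) f (y, s)).
Proof. by move=> df; split; [exact: derivable_slice_r|exact: derive_slice_r]. Qed.

End slices.

Section dot_calculus.
Context {R : realType} {E : normedModType R} {N : nat}.

Lemma is_derive_dot (a b : E -> 'rV[R]_N) (x v : E) (da db : 'rV[R]_N) :
  is_derive x v a da -> is_derive x v b db ->
  is_derive x v (fun y => dot (a y) (b y)) (dot da (b x) + dot (a x) db).
Proof.
move=> dax dbx.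
apply: is_derive_eq.
  apply: is_derive_sum_fin => k.
  exact: is_deriveM (is_derive_coord 0 k dax) (is_derive_coord 0 k dbx).
rewrite -big_split/=; apply: eq_bigr => k _.
rewrite [LHS]addrC; congr (_ + _); exact: mulrC.
Qed.

Lemma continuous_dot (T : topologicalType) (a b : T -> 'rV[R]_N) (x : T) :
  {for x, continuous a} -> {for x, continuous b} ->
  {for x, continuous (fun y => dot (a y) (b y))}.
Proof.
move=> ca cb.
have coord (c : T -> 'rV[R]_N) k : {for x, continuous c} ->
    {for x, continuous (fun y => c y 0 k)}.
  move=> cc; apply: (@continuous_comp _ _ _ c (fun M : 'rV[R]_N => M 0 k)) => //.
  exact: coord_continuous.
apply: cvg_big => [|k _]; first exact: add_continuous.
by apply: cvgM; exact: coord.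
Qed.

End dot_calculus.

(** [\adj A] is [\det A] times a symmetric inverse, so [B i j] and [B j i] contribute equally even
    when [B] is not symmetric. The resulting factor 2 is cancelled later by the square root in the
    volume density. *)
Lemma mxtrace_adj_sym (R : realType) n (A : 'M[R]_n) (B : 'I_n -> 'I_n -> R) :
  A^T = A -> \det A != 0 ->
  \tr (\adj A *m \matrix_(i, j) - (B i j + B j i)) =
  - (2 * \sum_i \sum_j invmx A i j * B i j) * \det A.
Proof.
move=> AT detA.
have adjE : \adj A = \det A *: invmx A.
  by rewrite /invmx unitmxE unitfE detA scalerA divff// scale1r.
have invT i j : invmx A i j = invmx A j i by rewrite -{1}AT -trmx_inv mxE.
rewrite adjE -scalemxAl mxtraceZ mulrC; congr (_ * _).
rewrite mulr2n mulrDl mul1r {2}exchange_big -big_split/= -sumrN.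
apply: eq_bigr => i _; rewrite mxE -big_split/= -sumrN.
apply: eq_bigr => j _; rewrite mxE (invT j i) mulrN mulrDr.
by congr (- _); exact: addrC.
Qed.

Section first_variation.
Context {R : realType} {n N : nat}.
Variables (g : 'rV[R]_n * R^o -> 'rV[R]_N) (U : set 'rV[R]_n) (V : 'rV[R]_N).
Hypothesis oU : open U.
Local Notation UR := [set z : 'rV[R]_n * R^o | U z.1].
Hypothesis gC2 : Ck_on 2 UR g.
Local Notation f s := (fun y : 'rV[R]_n => g (y, s)).
Local Notation e i := (delta_mx 0 i, 0) (only parsing).
Local Notation W := (fun z => 'D_(0, 1) g z - V).

Lemma open_cylinder : open UR.
Proof. by apply: open_comp => // z _; exact: cvg_fst. Qed.

Lemma partial_slice i s (h : 'rV[R]_n * R^o -> 'rV[R]_N) :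
  partial i (fun y => h (y, s)) = fun y => 'D_(delta_mx 0 i, 0) h (y, s).
Proof. by apply/funext => y; rewrite /partial derive_slice_l. Qed.

Lemma partial2_slice i j s :
  partial i (partial j (f s)) =
  fun y => 'D_(delta_mx 0 i, 0) ('D_(delta_mx 0 j, 0) g) (y, s).
Proof. by rewrite (partial_slice j) (partial_slice i s ('D_(delta_mx 0 j, 0) g)). Qed.

Let dg z v : UR z -> derivable g z v.
Proof. by have [_ /(_ v)[+ _]] := gC2; exact. Qed.

Let ddg z u v : UR z -> derivable ('D_u g) z v.
Proof. by have [_ /(_ u)[_ [_ /(_ v)[+ _]]]] := gC2; exact. Qed.

(* As [W] is orthogonal to the frame on all of [U], differentiating
   [dot W (partial l f) = 0] in space trades the derivative of [W] for [- dot W]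
   of a second derivative of [f]. *)
Lemma is_derive_metric y s i j : U y ->
  (forall y k, U y -> dot (W (y, s)) (partial k (f s) y) = 0) ->
  is_derive s 1 (fun s => induced_metric (f s) y i j)
    (- (dot (W (y, s)) (partial i (partial j (f s)) y)
      + dot (W (y, s)) (partial j (partial i (f s)) y))).
Proof.
move=> Uy W0.
have DW k l : dot ('D_(0, 1) ('D_(delta_mx 0 k, 0) g) (y, s)) (partial l (f s) y)
    = - dot (W (y, s)) (partial k (partial l (f s)) y).
  apply/eqP; rewrite -addr_eq0; apply/eqP.
  have dW : is_derive y (delta_mx 0 k) (fun y => W (y, s))
      ('D_(0, 1) ('D_(delta_mx 0 k, 0) g) (y, s)).
    (* Exchanging time and space derivatives turns the velocity of a frame vector into a spatial
       derivative of [W], as [V] is constant. *)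
    rewrite -(clairaut _ _ open_cylinder gC2)//.
    have := is_deriveB (is_derive_slice_l (ddg (u := (0, 1)) (v := (delta_mx 0 k, 0)) (Uy : UR (y, s))))
      (is_derive_cst V y (delta_mx 0 k)).
    by rewrite subr0.
  have dP : is_derive y (delta_mx 0 k) (partial l (f s))
      (partial k (partial l (f s)) y).
    rewrite partial2_slice (partial_slice l).
    by apply: is_derive_slice_l; exact: ddg.
  have [_ <-] := is_derive_dot dW dP.
  rewrite (@near_eq_derive _ _ _ _ (cst 0)) ?derive_cst//.
  near=> z; apply: W0; near: z; exact: open_nbhs_nbhs.
have dT k : is_derive s 1 (fun s => partial k (f s) y)
    ('D_(0, 1) ('D_(delta_mx 0 k, 0) g) (y, s)).
  under eq_fun do rewrite (partial_slice k).
  by apply: is_derive_slice_r; exact: ddg.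
under eq_fun do rewrite mxE.
have := is_derive_dot (dT i) (dT j).
by rewrite (DW i j) (dotC (partial i (f s) y)) (DW j i) opprD.
Unshelve. all: by end_near. Qed.

(** By Jacobi's formula the derivative of [\det g] is [- 2 <W, H> \det g], and the square root
    halves the rate. *)
Lemma is_derive_volume_density y s : U y ->
  (forall y k, U y -> dot (W (y, s)) (partial k (f s) y) = 0) ->
  row_free (tangent_frame (f s) y) ->
  is_derive s 1 (fun s => volume_density (f s) y)
    (- dot (W (y, s)) (local_mean_curvature (f s) y) * volume_density (f s) y).
Proof.
move=> Uy W0 Tfree.
pose w := W (y, s); pose F2 i j := partial i (partial j (f s)) y.
pose dA : 'M[R]_n := \matrix_(i, j) - (dot w (F2 i j) + dot w (F2 j i)).
have dAE i j : is_derive s 1 (fun s => induced_metric (f s) y i j) (dA i j).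
  by rewrite mxE; exact: is_derive_metric.
pose gm := induced_metric (f s) y.
have gm_gt0 : 0 < \det gm by rewrite /gm induced_metricE gram_det_gt0.
have gmT : gm^T = gm by rewrite /gm induced_metricE trmx_mul trmxK.
have wker : (w <= kermx (tangent_frame (f s) y)^T)%MS.
  by apply/dot_kerP => k; exact: W0.
(* As [w] is normal, it pairs equally with a second derivative of [f] and with its normal part, the
   second fundamental form. *)
have wH : dot w (local_mean_curvature (f s) y) =
    \sum_i \sum_j invmx gm i j * dot w (F2 i j).
  rewrite /local_mean_curvature dot_sumr; apply: eq_bigr => i _.
  rewrite dot_sumr; apply: eq_bigr => j _.
  by rewrite dotZr /second_fundamental_form -dot_normal_proj.
have trE : \tr (\adj gm *m dA) =
    - (2 * dot w (local_mean_curvature (f s) y)) * \det gm.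
  by rewrite wH mxtrace_adj_sym// gt_eqF.
have := is_derive1_comp (is_derive1_sqrt gm_gt0) (is_derive_det dAE).
move=> /is_derive_eq; apply; rewrite -/gm trE -/w.
have sq : \det gm = volume_density (f s) y ^+ 2.
  by rewrite /volume_density sqr_sqrtr// ltW.
rewrite /volume_density -/gm in sq *; rewrite {2}sq.
have sgm : Num.sqrt (\det gm) != 0 by rewrite gt_eqF// sqrtr_gt0.
by field.
Qed.

End first_variation.

(** * The weighted density along the flow *)

Section chart_change.
Context {R : realType} {n N : nat} {Sigma : ptopologicalType}.
Variable M : smooth_manifold R n Sigma.
Implicit Types (c : chart M) (p : Sigma).

Lemma open_chart_img c : open (chart_img c).
Proof. exact: chart_img_open. Qed.

Lemma mem_chart_img c p : chart_dom c p -> chart_img c (coord c p).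
Proof. by move=> cp; exists p. Qed.

Lemma near_chart_img c p (P : set Sigma) : chart_dom c p -> open P -> P p ->
  \forall y \near coord c p, chart_img c y /\ P (param c y).
Proof.
move=> cp oP Pp; have cy := mem_chart_img cp; apply: filterI.
  by apply: open_nbhs_nbhs; split=> //; exact: open_chart_img.
have /(_ _) := param_cts cy; apply.
by rewrite coordK//; exact: open_nbhs_nbhs.
Qed.

Definition transition_jacobian c c' p : 'M[R]_n :=
  \matrix_(i, j) 'D_(delta_mx 0 i) (coord c' \o param c) (coord c p) 0 j.

(** Near [coord c p] the map [in_chart f c] is [in_chart f c'] after the transition map, and the
    chain rule gives the rows. The identity holds only over the overlap of the charts, hence the
    comparison of derivatives through local equality. *)
Lemma tangent_frame_change (f : Sigma -> 'rV[R]_N) c c' p :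
  chart_dom c p -> chart_dom c' p ->
  (forall y j, chart_img c' y -> derivable (in_chart f c') y (delta_mx 0 j)) ->
  (forall j, {for coord c' p, continuous (partial j (in_chart f c'))}) ->
  tangent_frame (in_chart f c) (coord c p) =
  transition_jacobian c c' p *m tangent_frame (in_chart f c') (coord c' p).
Proof.
move=> cp c'p df cdf; apply/row_matrixP => i; rewrite rowK row_mul.
pose t := coord c' \o param c.
have tE : t (coord c p) = coord c' p by rewrite /t /= coordK.
have dt : derivable t (coord c p) (delta_mx 0 i).
  have [_ /(_ (delta_mx 0 i))[+ _]] := @transition_smooth _ _ _ M c c' 1.
  by apply; exists p.
have D k : is_derive (coord c p) (delta_mx 0 i) (fun y => in_chart f c' (t y) 0 k)
    (\sum_j 'D_(delta_mx 0 i) t (coord c p) 0 j *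
       partial j (in_chart f c') (coord c' p) 0 k).
  rewrite -tE; apply: (@derive_comp_C1 _ _ _ (fun y => in_chart f c' y 0 k)
    (fun j y => partial j (in_chart f c') y 0 k) (chart_img c') t) => //.
  - exact: open_chart_img.
  - by rewrite tE; exact: mem_chart_img.
  - move=> y j cy; apply: (is_derive_coord 0 k); apply: derivableP; exact: df.
  - by move=> j; apply: continuous_coord; rewrite tE.
have [_ DE] : is_derive (coord c p) (delta_mx 0 i) (in_chart f c)
    (row i (transition_jacobian c c' p) *m tangent_frame (in_chart f c') (coord c' p)).
  apply: (@near_eq_is_derive _ _ _ (in_chart f c' \o t)).
    near=> y; rewrite /in_chart /t /= coordK//.
    by near: y; apply: filterS (near_chart_img cp (chart_dom_open c') c'p) => y [].
  apply: is_derive_mx => a k; rewrite [a]ord1 !mxE.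
  under eq_bigr do rewrite !mxE.
  exact: D.
by rewrite -DE.
Unshelve. all: by end_near. Qed.

End chart_change.

Section flow.
Context {R : realType} {n N : nat} {Sigma : ptopologicalType}.
Variables (M : smooth_manifold R n Sigma) (V : 'rV[R]_N) (F : Sigma -> R -> 'rV[R]_N).
Hypothesis F_smooth : smooth_family M F.
Hypothesis F_immersion : forall s, immersion M (F ^~ s).
Hypothesis F_flow : forall p s,
  derive1 (F p) s = mean_curvature M (F ^~ s) p + tangent_part M (F ^~ s) p V.
Implicit Types (c : chart M) (p : Sigma) (s : R).

Local Notation G c := (fun z : 'rV[R]_n * R^o => F (param c z.1) z.2).

Definition soliton_defect s p : 'rV[R]_N :=
  mean_curvature M (F ^~ s) p - normal_part M (F ^~ s) p V.

(** Follows from [V = V^T + V^perp]. The defect is thereby the field [W] of the overview, expressed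
    without any choice of chart. *)
Lemma soliton_defectE s p : soliton_defect s p = derive1 (F p) s - V.
Proof.
by rewrite F_flow /soliton_defect /normal_part /tangent_part /= /normal_proj opprB addrA.
Qed.

Lemma soliton_defect_chart c s p : chart_dom c p ->
  soliton_defect s p = 'D_(0, 1) (G c) (coord c p, s) - V.
Proof.
move=> cp; rewrite soliton_defectE derive1E -(derive_slice_r (G c)).
by rewrite /= coordK.
Qed.

Let FC2 c : Ck_on 2 [set z : 'rV[R]_n * R^o | chart_img c z.1] (G c).
Proof. exact: F_smooth. Qed.

Lemma derivable_in_chart c s y v : chart_img c y ->
  derivable (in_chart (F ^~ s) c) y v.
Proof.
move=> cy; apply: (derivable_slice_l (f := G c)).
by have [_ /(_ (v, 0))[+ _]] := FC2 c; exact.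
Qed.

Lemma continuous_slice (W : normedModType R) (h : 'rV[R]_n * R^o -> W) y s :
  {for (y, s : R^o), continuous h} -> {for y, continuous (fun y => h (y, s : R^o))}.
Proof.
move=> ch; apply: cvg_comp ch => P [[A B] [/= yA sB] AB].
apply: filterS yA => z Az; apply: (AB (z, s)); split=> //.
exact: nbhs_singleton sB.
Qed.

Lemma continuous_partial_in_chart c s y j : chart_img c y ->
  {for y, continuous (partial j (in_chart (F ^~ s) c))}.
Proof.
move=> cy; rewrite (partial_slice j s (G c)).
apply: (continuous_slice (h := 'D_(delta_mx 0 j, 0) (G c))).
by have [_ /(_ (delta_mx 0 j, 0))[_ [+ _]]] := FC2 c; exact.
Qed.

Lemma continuous_in_chart c s y : chart_img c y ->
  {for y, continuous (in_chart (F ^~ s) c)}.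
Proof.
by move=> cy; apply: (continuous_slice (h := G c)); have [+ _] := FC2 c; exact.
Qed.

Lemma frame_change c c' s p : chart_dom c p -> chart_dom c' p ->
  tangent_frame (in_chart (F ^~ s) c) (coord c p) = transition_jacobian c c' p *m
    tangent_frame (in_chart (F ^~ s) c') (coord c' p).
Proof.
move=> cp c'p; apply: tangent_frame_change => // [y j|j].
  exact: derivable_in_chart.
by apply: continuous_partial_in_chart; exact: mem_chart_img.
Qed.

(** In the chart [chart_at M p] the defect is a combination of normal projections; the frame of any
    other chart is a Jacobian times the frame of that one. *)
Lemma soliton_defect_normal c s p j : chart_dom c p ->
  dot (soliton_defect s p) (partial j (in_chart (F ^~ s) c) (coord c p)) = 0.
Proof.
move=> cp; move: j; apply/dot_kerP; apply/sub_kermxP.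
rewrite (frame_change s cp (mem_chart_at M p)) trmx_mul mulmxA.
suff /sub_kermxP -> : (soliton_defect s p <=
    kermx (tangent_frame (in_chart (F ^~ s) (chart_at M p)) (coord (chart_at M p) p))^T)%MS.
  by rewrite mul0mx.
rewrite /soliton_defect addmx_sub//; last first.
  by rewrite eqmx_opp; exact: normal_proj_ker.
by do 2 (apply: summx_sub => ? _); apply: scalemx_sub; exact: normal_proj_ker.
Qed.

(* The Jacobian factor does not depend on [s], so time derivatives in any chart
   reduce to the chart [chart_at M p] in which the mean curvature is computed. *)
Lemma volume_density_change c c' s p : chart_dom c p -> chart_dom c' p ->
  volume_density (in_chart (F ^~ s) c) (coord c p) =
  `|\det (transition_jacobian c c' p)| *
    volume_density (in_chart (F ^~ s) c') (coord c' p).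
Proof.
move=> cp c'p; rewrite /volume_density !induced_metricE (frame_change s cp c'p).
set J := transition_jacobian c c' p; set T := tangent_frame _ _.
have -> : J *m T *m (J *m T)^T = J *m (T *m T^T) *m J^T.
  by rewrite trmx_mul !mulmxA.
by rewrite !det_mulmx det_tr mulrAC -expr2 sqrtrM ?sqr_ge0// sqrtr_sqr.
Qed.

Lemma is_derive_volume_density_chart_at p s :
  let c := chart_at M p in
  is_derive s 1 (fun s => volume_density (in_chart (F ^~ s) c) (coord c p))
    (- dot (soliton_defect s p) (mean_curvature M (F ^~ s) p) *
       volume_density (in_chart (F ^~ s) c) (coord c p)).
Proof.
move=> c; have cp : chart_dom c p := mem_chart_at M p.
have := @is_derive_volume_density _ _ _ (G c) (chart_img c) V (@chart_img_open _ _ _ M c) (FC2 c)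
  (coord c p) s (mem_chart_img cp).
rewrite (soliton_defect_chart s cp); apply; last first.
  by apply: F_immersion; exact: mem_chart_img.
(* The variation formula asks for normality at every point [q] of this chart, including those where
   [chart_at M q] is a different chart. *)
move=> y k [q cq <-].
by rewrite -(soliton_defect_chart s cq); exact: soliton_defect_normal.
Qed.

Definition weight s p : R := expR (dot (F p s - s *: V) V).

Definition dissipation s p : R := enorm (soliton_defect s p) ^+ 2 * weight s p.

Definition weighted_density c s p : R :=
  weight s p * volume_density (in_chart (F ^~ s) c) (coord c p).

(** The exponential contributes [<W, V>], because [F - s V] moves with velocity [W], and the volume
    contributes [- <W, H>]. As [W] is normal, [<W, V> = <W, V^perp>], and the sum is [- |W|^2]. *)
Lemma is_derive_weighted_density c p s : chart_dom c p ->
  is_derive s 1 (weighted_density c ^~ p)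
    (- (enorm (soliton_defect s p) ^+ 2 * weighted_density c s p)).
Proof.
move=> cp; pose c0 := chart_at M p; have c0p : chart_dom c0 p := mem_chart_at M p.
have dG : derivable (G c) (coord c p, s : R^o) (0, 1).
  by have [_ /(_ (0, 1))[+ _]] := FC2 c; apply; exact: mem_chart_img.
have GF : (fun t : R^o => G c (coord c p, t)) = F p.
  by apply/funext => t /=; rewrite coordK.
have dF : is_derive s 1 (F p) (derive1 (F p) s).
  have [+ _] := is_derive_slice_r dG; rewrite GF => dFp.
  by rewrite derive1E; exact: derivableP.
have dV : is_derive s 1 (fun r : R => r *: V) V.
  have := is_derive_line (is_derive_id (0 + s *: V) V).
  by rewrite (_ : (fun r : R => 0 + r *: V) = (fun r : R => r *: V))//;
    apply/funext => r; rewrite add0r.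
have dFV : is_derive s 1 (fun r => F p r - r *: V) (soliton_defect s p).
  by rewrite soliton_defectE; exact: is_deriveB.
have dE : is_derive s 1 (fun r => dot (F p r - r *: V) V) (dot (soliton_defect s p) V).
  have := is_derive_dot dFV (is_derive_cst V s 1).
  by rewrite [dot _ 0]dotE trmx0 mulmx0 mxE addr0.
have dexp := is_derive1_comp (is_derive_expR _) dE.
have dvol : is_derive s 1 (fun r => volume_density (in_chart (F ^~ r) c) (coord c p))
    (- dot (soliton_defect s p) (mean_curvature M (F ^~ s) p) *
       volume_density (in_chart (F ^~ s) c) (coord c p)).
  under eq_fun do rewrite (volume_density_change _ cp c0p).
  have := is_deriveZ `|\det (transition_jacobian c c0 p)|
    (is_derive_volume_density_chart_at p s).
  move=> /is_derive_eq; apply.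
  by rewrite (volume_density_change _ cp c0p) [LHS]mulrCA.
have := is_deriveM dexp dvol.
move=> /is_derive_eq; apply; rewrite /weighted_density /weight /=.
have nV : dot (soliton_defect s p) V = dot (soliton_defect s p) (normal_part M (F ^~ s) p V).
  rewrite /normal_part; apply: dot_normal_proj.
  by apply/dot_kerP => k; exact: soliton_defect_normal.
have -> : enorm (soliton_defect s p) ^+ 2 =
    dot (soliton_defect s p) (mean_curvature M (F ^~ s) p) - dot (soliton_defect s p) V.
  by rewrite enorm_sqr {2}/soliton_defect dotBr nV.
rewrite -[X in X + _ = _]/(_ * _) -[X in _ + X = _]/(_ * _).
move: (volume_density _ _) (dot _ V) (dot _ _) (expR _) => a b d e.
ring.
Qed.
End flow.

(** * Decay of integrals *)

Section change_of_variables.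
Local Open Scope ereal_scope.
Context d1 d2 (X : measurableType d1) (Y : measurableType d2) (R : realType).
Variables (nu : {measure set X -> \bar R}) (mu : {measure set Y -> \bar R}).
Variables (D' : set X) (D : set Y) (phi : X -> Y) (g : X -> R).
Hypothesis mD' : measurable D'.
Hypothesis mD : measurable D.
Hypothesis phiD : forall x, D' x -> D (phi x).
Hypothesis mphi : measurable_fun D' phi.
Hypothesis mg : measurable_fun D' g.
Hypothesis g0 : forall x, D' x -> (0 <= g x)%R.
Hypothesis muE : forall B, measurable B -> B `<=` D ->
  mu B = \int[nu]_(x in D' `&` phi @^-1` B) (g x)%:E.

Import HBNNSimple.

Let indic_patch B x : measurable B -> D' x ->
  ((\1_B (phi x) : R) * g x)%:E = ((EFin \o g) \_ (phi @^-1` B)) x.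
Proof.
move=> mB D'x; rewrite /patch /= indicE -[phi x \in B]/(x \in phi @^-1` B).
by case: ifPn => _; rewrite ?mul1r ?mul0r.
Qed.

Let integral_indic_density B : measurable B ->
  \int[mu]_(y in D) (\1_B y)%:E = \int[nu]_(x in D') (\1_B (phi x) * g x)%:E.
Proof.
move=> mB; rewrite integral_indic// muE//; last exact: measurableI.
rewrite (_ : D' `&` phi @^-1` (B `&` D) = D' `&` phi @^-1` B); last first.
  apply/seteqP; split=> x [D'x]; first by case.
  by move=> Bx; split=> //; split=> //; exact: phiD.
rewrite integral_mkcondr; apply: eq_integral => x /[!inE] D'x.
by rewrite indic_patch.
Qed.

Let mcomp (f : Y -> R) : measurable_fun setT f -> measurable_fun D' (f \o phi).
Proof. by move=> mf; exact: measurableT_comp. Qed.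

Let integral_nnsfun_density (f : {nnsfun Y >-> R}) :
  \int[mu]_(y in D) (f y)%:E = \int[nu]_(x in D') (f (phi x) * g x)%:E.
Proof.
transitivity (\sum_(k \in range f)
    \int[mu]_(y in D) (k * \1_(f @^-1` [set k]) y)%:E).
  under eq_integral do rewrite fimfunE -fsumEFin//.
  rewrite ge0_integral_fsum//.
  - by move=> y; exact/measurable_EFinP/measurable_funM.
  - by move=> y x _; rewrite nnfun_muleindic_ge0.
transitivity (\sum_(k \in range f)
    \int[nu]_(x in D') (k * (\1_(f @^-1` [set k]) (phi x) * g x))%:E); last first.
  rewrite -ge0_integral_fsum//.
  - apply: eq_integral => x _; rewrite fsumEFin//; congr EFin.
    rewrite [in RHS]fimfunE mulr_fsuml; apply: eq_fsbigr => k _.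
    by rewrite mulrA.
  - move=> k; apply/measurable_EFinP/measurable_funM => //.
    by apply: measurable_funM => //; exact: mcomp.
  - move=> k x D'x; rewrite mulrA EFinM mule_ge0 ?nnfun_muleindic_ge0//.
    by rewrite lee_fin g0.
apply: eq_fsbigr => k _; rewrite integralZl_indic_nnsfun// integral_indic_density//.
(* A negative [k] is not a value of [f], so both sides vanish. *)
have [k0|k0] := ltP k 0%R.
  rewrite preimage_nnfun0//.
  by rewrite !integral0_eq ?mule0// => x _; rewrite indic0 ?mul0r ?mulr0.
under [RHS]eq_integral do rewrite EFinM.
rewrite ge0_integralZl//.
- apply/measurable_EFinP/measurable_funM => //; exact: mcomp.
- by move=> x D'x; rewrite lee_fin mulr_ge0// g0.
Qed.

(** [muE] describes [mu] on measurable subsets of [D] only, which is the form [is_volume_measure]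
    provides; indicators, simple functions and monotone convergence carry it over to nonnegative
    integrands. *)
Lemma integral_density (h : Y -> R) : measurable_fun D h ->
  (forall y, D y -> (0 <= h y)%R) ->
  \int[mu]_(y in D) (h y)%:E = \int[nu]_(x in D') (h (phi x) * g x)%:E.
Proof.
move=> mh h0.
have meh : measurable_fun D (EFin \o h) by exact/measurable_EFinP.
pose f_ := nnsfun_approx mD meh.
have f_cvg y : D y -> (f_ n y)%:E @[n --> \oo] --> (h y)%:E.
  by move=> Dy; apply: (cvg_nnsfun_approx mD meh) => // z Dz; rewrite lee_fin h0.
have f_nd y m n : (m <= n)%N -> (f_ m y <= f_ n y)%R.
  by move=> mn; exact/lefP/nd_nnsfun_approx.
transitivity (limn (fun n => \int[mu]_(y in D) (f_ n y)%:E)).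
  rewrite -monotone_convergence//.
  - by apply: eq_integral => y /[!inE] Dy; apply/esym/cvg_lim => //; exact: f_cvg.
  - by move=> n; exact/measurable_EFinP/measurable_funP.
  - by move=> n y _; rewrite lee_fin.
  - by move=> y _ m n mn; rewrite lee_fin; exact: f_nd.
under eq_fun do rewrite integral_nnsfun_density.
rewrite -monotone_convergence//.
- apply: eq_integral => x /[!inE] D'x; apply/cvg_lim => //.
  under eq_fun do rewrite EFinM.
  rewrite EFinM; apply: cvgeZr => //; exact: f_cvg (phiD D'x).
- move=> n; apply/measurable_EFinP; apply: measurable_funM => //.
  exact: mcomp.
- by move=> n x D'x; rewrite lee_fin mulr_ge0// g0.
- by move=> x D'x m n mn; rewrite lee_fin ler_wpM2r ?g0// f_nd.
Qed.

End change_of_variables.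

Section decay.
Context d (X : measurableType d) (R : realType).
Variables (nu : {measure set X -> \bar R}) (D : set X) (rho : R -> X -> R).
Variables (i : R -> R).
Hypothesis mD : measurable D.
Hypothesis mrho : forall s, measurable_fun D (rho s).
Hypothesis rho0 : forall s x, D x -> 0 <= rho s x.
Hypothesis rho_nincr : forall x, D x -> {homo rho^~ x : a b / a <= b >-> b <= a}.
Hypothesis iE : forall s, (\int[nu]_(x in D) (rho s x)%:E)%E = (i s)%:E.

(** The integral of the difference comes from additivity applied to [rho s = (rho s - rho (s + h)) +
    rho (s + h)], whose terms are nonnegative, and from cancelling a term that is finite by [iE]. *)
Lemma integral_increment (s h : R) : 0 < h ->
  (\int[nu]_(x in D) ((rho s x - rho (s + h) x) / h)%:E)%E
    = ((i s - i (s + h)) / h)%:E.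
Proof.
move=> h0.
have mB : measurable_fun D (fun x => rho s x - rho (s + h) x).
  exact: measurable_funB.
have B0 x : D x -> 0 <= rho s x - rho (s + h) x.
  by move=> Dx; rewrite subr_ge0 rho_nincr// lerDl ltW.
have IB : (\int[nu]_(x in D) (rho s x - rho (s + h) x)%:E)%E = (i s - i (s + h))%:E.
  have : (\int[nu]_(x in D) ((rho s x - rho (s + h) x)%:E + (rho (s + h) x)%:E) =
      (i s)%:E)%E.
    by rewrite -iE; apply: eq_integral => x _; rewrite -EFinD subrK.
  rewrite ge0_integralD//.
  - rewrite iE => e; rewrite EFinB -e addeK//.
  - exact/measurable_EFinP.
  - by move=> x Dx; rewrite lee_fin rho0.
  - exact/measurable_EFinP.
under eq_integral do rewrite mulrC EFinM.
rewrite ge0_integralZl_EFin ?invr_ge0 ?(ltW h0)//.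
- by rewrite IB -EFinM mulrC.
- exact/measurable_EFinP.
Qed.

(* Fatou's lemma for the difference quotients of [rho] at [s] avoids any domination
   or continuity in time of the derivative. *)
Lemma fatou_decay (s e : R) (delta : X -> R) :
  (forall x, D x -> is_derive s 1 (rho^~ x) (- delta x)) ->
  (e%:E < \int[nu]_(x in D) (delta x)%:E)%E ->
  exists2 r, 0 < r & forall h, 0 < h < r -> i (s + h) <= i s - e * h.
Proof.
move=> drho; apply: contraPP => noT; apply/negP; rewrite -leNgt.
have slow r : 0 < r -> exists h, 0 < h < r /\ i s - e * h < i (s + h).
  move=> r0; apply: contrapT => nh; apply: noT; exists r => // h hr.
  by rewrite leNgt; apply/negP => lt; apply: nh; exists h.
(* The steps [h n] tend to 0 while the mean drop over each stays below [e]; Fatou's lemma along this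
   sequence bounds the integral of [delta] by [e]. *)
have /choice[h hP] (n : nat) : exists h : R, 0 < h < n.+1%:R^-1 /\ i s - e * h < i (s + h).
  by apply: slow; rewrite invr_gt0.
pose q n x := ((rho s x - rho (s + h n) x) / h n)%:E.
have h0 n : 0 < h n by have [/andP[]] := hP n.
have cvgh0 : h n @[n --> \oo] --> (0 : R).
  apply: (squeeze_cvgr _ (cvg_cst 0) (@cvg_harmonic R)).
  by near=> n; have [/andP[a b] _] := hP n; rewrite !ltW.
have qlim x : D x -> q n x @[n --> \oo] --> (delta x)%:E.
  move=> Dx; apply: cvg_EFin; first by near=> n.
  have [+ dE] := drho x Dx.
  move=> dfx; have hn0 n : h n != 0 by rewrite gt_eqF.
  have := (cvgr_dnbhsP _ _ _).1 dfx h (conj hn0 cvgh0).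
  rewrite -[lim _]/('D_1 (rho^~ x) s) dE => /cvgN; rewrite opprK.
  apply: cvg_trans; apply: near_eq_cvg; near=> n.
  rewrite -[LHS]/(- ((h n)^-1 * (rho (h n * 1 + s) x - rho s x))) /q /=.
  by rewrite mulr1 -mulrN opprB mulrC [h n + s]addrC.
have -> : (\int[nu]_(x in D) (delta x)%:E = \int[nu]_(x in D) limn_einf (q ^~ x))%E.
  apply: eq_integral => x /[!inE] Dx.
  by rewrite is_cvg_limn_einfE; [apply/esym/cvg_lim => //|apply: cvgP]; exact: qlim.
apply: (le_trans (fatou _ _ _ _)) => //.
- move=> n; apply/measurable_EFinP; apply: measurable_funM => //.
  exact: measurable_funB.
- move=> n x Dx; rewrite lee_fin divr_ge0// ?(ltW (h0 n))// subr_ge0 rho_nincr//.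
  by rewrite lerDl ltW.
have qe n : (\int[nu]_(x in D) q n x <= e%:E)%E.
  rewrite integral_increment// lee_fin ler_pdivrMr//.
  by have [_ /ltW] := hP n; rewrite lerBlDl lerBlDr.
rewrite limn_einf_lim; apply: lime_le; first exact: is_cvg_einfs.
near=> n; apply: le_trans (qe n); apply: ereal_inf_lbound; exists n => //=.
Unshelve. all: by end_near. Qed.

End decay.

(* Monotonicity alone shows that the supremum of the times at which the total drop
   is large enough is again such a time; no continuity of [i] is needed. *)
Lemma nincr_total_drop (R : realType) (i : R -> R) (a b e : R) : a <= b -> 0 <= e ->
  {homo i : x y / x <= y >-> y <= x} ->
  (forall s, a <= s -> s < b -> exists2 r, 0 < r &
    forall h, 0 < h < r -> i (s + h) <= i s - e * h) ->
  i b <= i a - e * (b - a).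
Proof.
move=> ab e0 ni drop.
pose S := [set t : R | a <= t <= b /\ i t <= i a - e * (t - a)].
have Sa : S a by split; [rewrite lexx|rewrite subrr mulr0 subr0].
have supS : has_sup S by split; [exists a|exists b => t [/andP[]]].
have ub t : S t -> t <= sup S by move=> St; apply: sup_ubound; case: supS.
have Sc : S (sup S).
  have ac := ub a Sa.
  have cb : sup S <= b by rewrite ge_sup//; [exists a|move=> t [/andP[]]].
  split; first by rewrite ac.
  (* For [e > 0], membership of [sup S] amounts to an upper bound on [sup S]: each [t] in [S]
     satisfies [e * (t - a) <= i a - i t <= i a - i (sup S)]. *)
  have [->|e_neq0] := eqVneq e 0.
    by rewrite mul0r subr0; exact: ni.
  have e_gt0 : 0 < e by rewrite lt_def e_neq0.
  suff : sup S <= a + (i a - i (sup S)) / e.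
    by rewrite -lerBlDl ler_pdivlMr// mulrC => h; rewrite lerBrDr -lerBrDl.
  apply: ge_sup; first by exists a.
  move=> t St; have [/andP[at_ tb] it] := St.
  rewrite -lerBlDl ler_pdivlMr// mulrC.
  have := ni _ _ (ub t St); lra.
have [/andP[ac cb'] ic] := Sc.
have [cb|bc] := ltP (sup S) b; last first.
  have e1 : sup S = b by apply/eqP; rewrite eq_le cb' bc.
  by rewrite e1 in ic.
have [r r0 hr] := drop (sup S) ac cb.
(* Halving gives the strict [h < r], and the cap keeps [sup S + h] below [b]. This point lies in [S]
   again, beyond its supremum. *)
pose h := Num.min (r / 2) (b - sup S).
have h0 : 0 < h by rewrite lt_min subr_gt0 cb divr_gt0.
have hlt : h < r by rewrite gt_min ltr_pdivrMr// ltr_pMr// ltr1n.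
have hb : h <= b - sup S by rewrite ge_min lexx orbT.
have Sch : S (sup S + h).
  have := hr h; rewrite h0 hlt => /(_ isT) ih.
  split; first by apply/andP; split; lra.
  have -> : e * (sup S + h - a) = e * (sup S - a) + e * h by ring.
  lra.
have := ub _ Sch; lra.
Qed.

(* If at every time some [J m] exceeded [e], the sum of the [i m] would drop at rate
   [e] forever. *)
Lemma exists_small_rates (R : realType) (k : nat) (i : 'I_k -> R -> R)
    (J : 'I_k -> R -> \bar R) (lo hi : 'I_k -> R) (e : R) : 0 < e ->
  (forall m, {homo i m : x y / x <= y >-> y <= x}) ->
  (forall m s, lo m <= i m s <= hi m) ->
  (forall m s, (e%:E < J m s)%E -> exists2 r, 0 < r &
    forall h, 0 < h < r -> i m (s + h) <= i m s - e * h) ->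
  exists2 T, 0 <= T &
    forall a, exists s, a <= s <= a + T /\ forall m, (J m s <= e%:E)%E.
Proof.
move=> e0 ni ilh drop.
pose C := \sum_m (hi m - lo m).
have C0 : 0 <= C.
  by apply: sumr_ge0 => m _; have /andP[a b] := ilh m 0; rewrite subr_ge0 (le_trans a).
have T0 : 0 <= C / e + 1 by rewrite addr_ge0// divr_ge0// ltW.
(* [C] bounds the drop of the sum over any interval; a drop at rate [e] over the length [C / e + 1]
   would exceed it by [e]. *)
exists (C / e + 1) => // a; apply: contrapT => /forallNP noS.
pose I s := \sum_m i m s.
have niI : {homo I : x y / x <= y >-> y <= x}.
  by move=> x y xy; apply: ler_sum => m _; exact: ni.
have : I (a + (C / e + 1)) <= I a - e * (a + (C / e + 1) - a).
  apply: nincr_total_drop => //; rewrite ?lerDl ?(ltW e0)// => s as_ sT.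
  have [m Jm] : exists m, (e%:E < J m s)%E.
    apply: contrapT => /forallNP nJ; apply: (noS s); split.
      by rewrite as_ ltW.
    by move=> m; rewrite leNgt; apply/negP; exact: nJ.
  have [r r0 hr] := drop m s Jm; exists r => // h hh.
  rewrite /I (bigD1 m)//= [in leRHS](bigD1 m)//= addrAC lerD//; first exact: hr.
  by apply: ler_sum => l _; apply: ni; rewrite lerDl; case/andP: hh => /ltW.
have : I a - I (a + (C / e + 1)) <= C.
  rewrite -sumrB; apply: ler_sum => m _.
  have /andP[_ h1] := ilh m a; have /andP[h2 _] := ilh m (a + (C / e + 1)).
  by rewrite lerB.
have -> : e * (a + (C / e + 1) - a) = C + e.
  by field; rewrite gt_eqF.
lra.
Qed.

(** * Measurability of open sets in coordinates *)

Section tuple_topology.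
Context {R : realType} {n : nat}.
Local Notation row_of t := (\row_(i < n) tnth t i).

(** Tuples carry the product sigma-algebra, so an open set is written as the countable union of the
    cubes with rational centre and half-width that it contains. *)
Lemma measurable_row_open (A : set 'rV[R]_n) : open A ->
  measurable [set t : n.-tuple (measurableTypeR R) | A (row_of t)].
Proof.
move=> oA.
pose B (q : {ffun 'I_n -> rat} * rat) : set (n.-tuple (measurableTypeR R)) :=
  \bigcap_(i in [set: 'I_n]) [set t | tnth t i \in `]ratr (q.1 i) - ratr q.2, ratr (q.1 i) + ratr q.2[%R].
pose Q := [set q | B q `<=` [set t | A (row_of t)]].
have -> : [set t : n.-tuple (measurableTypeR R) | A (row_of t)] =
    \bigcup_(q in Q) B q.
  apply/seteqP; split=> [t At|t [q /[swap]]]; last by move=> Bt /(_ _ Bt).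
  have /nbhs_ballP[r /= r0 rA] : nbhs (row_of t) A by exact: open_nbhs_nbhs.
  (* Two points of a cube of half-width [ratr s] differ by less than [2 * ratr s < r] in each
     coordinate. *)
  have [s /andP[s0 sr]] : exists s : rat, (0 < (ratr s : R) < r / 2).
    have := @rat_in_itvoo R 0 (r / 2); rewrite divr_gt0// => /(_ isT)[s].
    by rewrite in_itv/= => sI; exists s.
  have /choice[q hq] (i : 'I_n) : exists q : rat,
      tnth t i - ratr s < ratr q < tnth t i + ratr s.
    have := @rat_in_itvoo R (tnth t i - ratr s) (tnth t i + ratr s).
    rewrite ltrD2l gtrN// => /(_ isT)[q].
    by rewrite in_itv/= => qI; exists q.
  exists ([ffun i => q i], s); last first.
    by move=> i _ /=; rewrite in_itv/= ffunE; have := hq i; lra.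
  move=> u uB; apply: rA; rewrite -ball_normE/= [ltLHS]/Num.Def.normr/= mx_normrE.
  apply/bigmax_ltP; split=> // -[a i] _ /=; rewrite !mxE.
  have := uB i I; rewrite /= in_itv/= ffunE => ui; have := hq i.
  by rewrite ltr_norml; lra.
rewrite bigcup_mkcond; apply: countable_bigcupT_measurable => // q.
case: ifPn => _ //; apply: fin_bigcap_measurable => // i _.
set I := `]_, _[; have mI : measurable ([set` I] : set (measurableTypeR R)).
  exact: measurable_itv.
by have := @measurable_tnth _ (measurableTypeR R) n i measurableT _ mI; rewrite setTI.
Qed.

End tuple_topology.

(** * Integrals over chart domains *)

Lemma open_setI_preimage (T U : topologicalType) (A : set T) (f : T -> U) (O : set U) :
  open A -> (forall x, A x -> {for x, continuous f}) -> open O ->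
  open (A `&` f @^-1` O).
Proof.
move=> oA cf oO; rewrite openE => x [Ax Ox]; apply: filterI.
  exact: open_nbhs_nbhs.
by apply: cf => //; exact: open_nbhs_nbhs.
Qed.

Lemma measurable_open_continuous (R : realType) (T : ptopologicalType) (A : set T)
    (f : T -> R) :
  open A -> (forall x, A x -> {for x, continuous f}) ->
  measurable_fun (A : set (g_sigma_algebraType (@open T))) f.
Proof.
move=> oA cf; apply: (measurability _ (RGenOpens.measurableE R)).
move=> _ [_ [a [b ->] <-]]; apply: sub_sigma_algebra.
by apply: open_setI_preimage => //; exact: interval_open.
Qed.

Lemma continuous_det (R : realType) (T : topologicalType) n (A : T -> 'M[R]_n) (x : T) :
  (forall i j, {for x, continuous (fun y => A y i j)}) ->
  {for x, continuous (fun y => \det (A y))}.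
Proof.
move=> cA; apply: cvg_big => [|s _]; first exact: add_continuous.
apply: cvgM; first exact: cvg_cst.
by apply: cvg_big => [|i _]; [exact: mul_continuous|exact: cA].
Qed.

Section row_measurable.
Context {R : realType} {n : nat}.
Local Notation row_of := (fun t : n.-tuple (measurableTypeR R) => \row_(i < n) tnth t i).
Variable A : set 'rV[R]_n.
Hypothesis oA : open A.

Lemma measurable_row_continuous (f : 'rV[R]_n -> R) :
  (forall y, A y -> {for y, continuous f}) ->
  measurable_fun (row_of @^-1` A) (f \o row_of).
Proof.
move=> cf; apply: (measurability _ (RGenOpens.measurableE R)).
move=> _ [_ [a [b ->] <-]].
apply: (measurable_row_open (A := A `&` f @^-1` `]a, b[)).
by apply: open_setI_preimage => //; exact: interval_open.
Qed.

Lemma measurable_row_map (T : ptopologicalType)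
    (f : 'rV[R]_n -> g_sigma_algebraType (@open T)) :
  (forall y, A y -> {for y, continuous (f : _ -> T)}) ->
  measurable_fun (row_of @^-1` A) (f \o row_of).
Proof.
move=> cf.
apply: (@measurability _ _ _ (g_sigma_algebraType (@open T)) _ _ (@open T)) => //.
move=> _ [B oB <-].
apply: (measurable_row_open (A := A `&` f @^-1` B)).
exact: open_setI_preimage.
Qed.

End row_measurable.

Lemma is_derive_nincr (R : realType) (f d : R -> R) :
  (forall s : R, is_derive s 1 f (- d s)) -> (forall s, 0 <= d s) ->
  {homo f : a b / a <= b >-> b <= a}.
Proof.
move=> df d0 a b ab.
apply: (@ler0_derive1_le_cc R f a b) => //.
- by move=> x _; rewrite derive1E; have [_ ->] := df x; rewrite oppr_le0.
- by apply: derivable_within_continuous => x _; have [] := df x.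
- by rewrite in_itv/= ab lexx.
- by rewrite in_itv/= ab lexx.
Qed.

Section chart_integrals.
Context {R : realType} {n N : nat} {Sigma : ptopologicalType}.
Variables (M : smooth_manifold R n Sigma) (V : 'rV[R]_N) (F : Sigma -> R -> 'rV[R]_N).
Variable mu : R -> {measure set (g_sigma_algebraType (@open Sigma)) -> \bar R}.
Hypothesis F_smooth : smooth_family M F.
Hypothesis F_immersion : forall s, immersion M (F ^~ s).
Hypothesis F_volume : forall s, is_volume_measure M (F ^~ s) (mu s).
Hypothesis F_flow : forall p s,
  derive1 (F p) s = mean_curvature M (F ^~ s) p + tangent_part M (F ^~ s) p V.
Implicit Types (c : chart M) (p : Sigma) (s : R).
Local Notation row_of := (fun t : n.-tuple (measurableTypeR R) => \row_(i < n) tnth t i).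
Local Notation G c := (fun z : 'rV[R]_n * R^o => F (param c z.1) z.2).

Local Notation defect := (soliton_defect M V F).
Local Notation weight := (weight V F).
Local Notation dissipation := (dissipation M V F).

Lemma continuous_chart (T : topologicalType) (h : Sigma -> T) c (k : 'rV[R]_n -> T) p :
  chart_dom c p -> (forall q, chart_dom c q -> h q = k (coord c q)) ->
  {for coord c p, continuous k} -> {for p, continuous h}.
Proof.
move=> cp hk ck; suff : h @ p --> k (coord c p) by rewrite -(hk p cp).
apply: (@cvg_trans _ ((k \o coord c) @ p)).
  apply: near_eq_cvg; near=> q; rewrite hk//.
  near: q; apply: open_nbhs_nbhs; split=> //; exact: chart_dom_open.
by apply: continuous_comp => //; exact: coord_cts.
Unshelve. all: by end_near. Qed.

Lemma continuous_position s : continuous (F ^~ s).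
Proof.
move=> p; have cp := mem_chart_at M p.
apply: (continuous_chart (k := in_chart (F ^~ s) (chart_at M p)) cp) => [q cq|].
  by rewrite /in_chart /= coordK.
by apply: continuous_in_chart => //; exact: mem_chart_img.
Qed.

(** The defining formula uses a chart that changes with the point; continuity is read instead from
    the time derivative of [F] in one fixed chart. *)
Lemma continuous_defect s : continuous (defect s).
Proof.
move=> p; have cp := mem_chart_at M p; set c := chart_at M p in cp *.
apply: (continuous_chart (k := fun y => 'D_(0, 1) (G c) (y, s) - V) cp) => [q cq|].
  exact: soliton_defect_chart.
apply: continuousB; last exact: cst_continuous.
apply: (continuous_slice (h := 'D_(0, 1) (G c))).
by have [_ /(_ (0, 1))[_ [+ _]]] := F_smooth c 2; apply; exact: mem_chart_img.
Qed.

Lemma continuous_weight s : continuous (weight s).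
Proof.
move=> p; apply: (@continuous_comp _ _ _ (fun p => dot (F p s - s *: V) V) expR).
  apply: continuous_dot; last exact: cst_continuous.
  by apply: continuousB; [exact: continuous_position|exact: cst_continuous].
exact: continuous_expR.
Qed.

Lemma continuous_dissipation s : continuous (dissipation s).
Proof.
move=> p.
apply: (@continuousM R Sigma (fun p => enorm (defect s p) ^+ 2) (weight s) p).
  rewrite (_ : (fun p => _) = fun p => dot (defect s p) (defect s p)).
    by apply: continuous_dot; exact: continuous_defect.
  by apply/funext => q; rewrite enorm_sqr.
exact: continuous_weight.
Qed.

Lemma continuous_volume_density c s y : chart_img c y ->
  {for y, continuous (volume_density (in_chart (F ^~ s) c))}.
Proof.
move=> cy; apply: (@continuous_comp _ _ _
  (fun y => \det (induced_metric (in_chart (F ^~ s) c) y)) Num.sqrt); last first.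
  exact: sqrt_continuous.
apply: continuous_det => i j.
rewrite (_ : (fun y => _) = fun y => dot (partial i (in_chart (F ^~ s) c) y)
    (partial j (in_chart (F ^~ s) c) y)).
  by apply: continuous_dot; exact: continuous_partial_in_chart.
by apply/funext => z; rewrite mxE.
Qed.

Lemma coord_imageE c (D : set Sigma) : D `<=` chart_dom c ->
  coord c @` D = chart_img c `&` param c @^-1` D.
Proof.
move=> Dc; apply/seteqP; split=> y.
  by move=> [p Dp <-]; split; [exists p => //; exact: Dc|rewrite /= coordK//; exact: Dc].
by move=> [[p cp <-]]; rewrite /= coordK// => Dp; exists p.
Qed.

Lemma open_coord_image c (D : set Sigma) : open D -> D `<=` chart_dom c ->
  open (coord c @` D).
Proof.
move=> oD Dc; rewrite coord_imageE//; apply: open_setI_preimage => //.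
  exact: chart_img_open.
by move=> y cy; exact: param_cts.
Qed.

Section one_chart.
Variables (c : chart M) (D : set Sigma).
Hypothesis oD : open D.
Hypothesis Dc : D `<=` chart_dom c.
Local Notation D' := (row_of @^-1` (coord c @` D)).
Local Notation leb := (lebesgue_tuple R n).
Local Notation rho := (fun s t => weighted_density V F c s (param c (row_of t))).

Let oD' : open (coord c @` D). Proof. exact: open_coord_image. Qed.

Let imgD y : (coord c @` D) y -> chart_img c y.
Proof. by rewrite coord_imageE// => -[]. Qed.

Let coord_param y : (coord c @` D) y -> coord c (param c y) = y.
Proof. by move=> [p Dp <-]; rewrite coordK//; exact: Dc. Qed.

Let param_D y : (coord c @` D) y -> D (param c y).
Proof. by rewrite coord_imageE// => -[]. Qed.

Let mD' : measurable D'. Proof. exact: (measurable_row_open oD'). Qed.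

Let mD : measurable (D : set (g_sigma_algebraType (@open Sigma))).
Proof. exact: sub_sigma_algebra. Qed.

Lemma integral_chart s (h : Sigma -> R) : continuous h -> (forall p, 0 <= h p) ->
  (\int[mu s]_(p in D) (h p)%:E = \int[leb]_(t in D')
    (h (param c (row_of t)) * volume_density (in_chart (F ^~ s) c) (row_of t))%:E)%E.
Proof.
move=> ch h0.
apply: (@integral_density _ _ _ _ _ leb (mu s) D' D (param c \o row_of)
  (volume_density (in_chart (F ^~ s) c) \o row_of)) => //.
- by move=> t /param_D.
- apply: measurable_row_map => // y /imgD cy; exact: param_cts.
- by apply: measurable_row_continuous => // y /imgD; exact: continuous_volume_density.
- by move=> t _; exact: sqrtr_ge0.
- move=> B mB BD; rewrite (F_volume s (c := c) mB); last by move=> p /BD /Dc.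
  congr integral; apply/seteqP; split=> t /=.
    move=> [p Bp pE]; split; first by exists p => //; exact: BD.
    by rewrite -pE coordK//; apply: Dc; exact: BD.
  by move=> [Dt Bt]; exists (param c (row_of t)) => //; exact: coord_param.
- by apply: measurable_open_continuous => // p _; exact: ch.
Qed.

Let rhoE s t : D' t -> rho s t = weight s (param c (row_of t)) *
  volume_density (in_chart (F ^~ s) c) (row_of t).
Proof. by move=> Dt; rewrite /weighted_density coord_param. Qed.

Let mrho s : measurable_fun D' (rho s).
Proof.
apply: (@eq_measurable_fun _ _ _ _ _ ((fun y => weight s (param c y) *
    volume_density (in_chart (F ^~ s) c) y) \o row_of)).
  by move=> t /[!inE] Dt; rewrite rhoE.
apply: measurable_row_continuous => // y /imgD cy.
apply: (@continuousM R _ (fun y => weight s (param c y))); last first.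
  exact: continuous_volume_density.
apply: (@continuous_comp _ _ _ (param c) (weight s)).
  exact: param_cts.
exact: continuous_weight.
Qed.

Let drho s t : D' t -> is_derive s 1 (rho^~ t)
  (- (enorm (defect s (param c (row_of t))) ^+ 2 * rho s t)).
Proof.
move=> /param_D /Dc cp.
exact: (is_derive_weighted_density F_smooth F_immersion F_flow s cp).
Qed.

Let rho0 s t : 0 <= rho s t.
Proof. by rewrite /weighted_density mulr_ge0 ?expR_ge0 ?sqrtr_ge0. Qed.

Let rho_nincr t : D' t -> {homo rho^~ t : a b / a <= b >-> b <= a}.
Proof.
move=> Dt; apply: is_derive_nincr => s; first exact: drho.
by rewrite mulr_ge0 ?sqr_ge0.
Qed.

Let weightE s : (\int[mu s]_(p in D) (weight s p)%:E =
  \int[leb]_(t in D') (rho s t)%:E)%E.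
Proof.
rewrite integral_chart => [||p]; last exact: expR_ge0; last first.
  exact: continuous_weight.
by apply: eq_integral => t /[!inE] Dt; rewrite rhoE.
Qed.

Let dissipationE s : (\int[mu s]_(p in D) (dissipation s p)%:E =
  \int[leb]_(t in D') (enorm (defect s (param c (row_of t))) ^+ 2 * rho s t)%:E)%E.
Proof.
rewrite integral_chart => [||p]; last by rewrite mulr_ge0 ?expR_ge0 ?sqr_ge0.
  by apply: eq_integral => t /[!inE] Dt; rewrite rhoE// mulrA.
exact: continuous_dissipation.
Qed.

(** A nonincreasing function lies between its two limits, so the weighted volume is finite at every
    time and its real value can serve as [i]. The dissipation integral stays in the extended reals,
    where it may be infinite. *)
Lemma chart_decay (lm lp : R) :
  (\int[mu s]_(p in D) (weight s p)%:E)%E @[s --> +oo] --> lp%:E ->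
  (\int[mu s]_(p in D) (weight s p)%:E)%E @[s --> -oo] --> lm%:E ->
  exists i : R -> R, [/\ {homo i : a b / a <= b >-> b <= a},
    forall s, lp <= i s <= lm &
    forall s e, (e%:E < \int[mu s]_(p in D) (dissipation s p)%:E)%E ->
      exists2 r, 0 < r & forall h, 0 < h < r -> i (s + h) <= i s - e * h].
Proof.
pose I s := (\int[mu s]_(p in D) (weight s p)%:E)%E.
have nI a b : a <= b -> (I b <= I a)%E.
  move=> ab; rewrite /I (weightE a) (weightE b).
  apply: ge0_le_integral; first exact: mD'.
  - by move=> t _; rewrite lee_fin.
  - exact/measurable_EFinP.
  - exact/measurable_EFinP.
  - by move=> t Dt; rewrite lee_fin rho_nincr.
move=> Ilp Ilm.
have Ile s : (I s <= lm%:E)%E.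
  apply: (cvge_ge _ Ilm); near=> r; apply: nI; near: r.
  apply: nbhs_ninfty_le; exact: num_real.
have Ige s : (lp%:E <= I s)%E.
  apply: (cvge_le _ Ilp); near=> r; apply: nI; near: r.
  apply: nbhs_pinfty_ge; exact: num_real.
have If s : I s = (fine (I s))%:E.
  by rewrite fineK// fin_numE; have := Ile s; have := Ige s; case: (I s).
exists (fine \o I); split=> [a b ab|s|s e].
- by rewrite -lee_fin -!If nI.
- by rewrite -!lee_fin -If Ige Ile.
have iE r : (\int[leb]_(t in D') (rho r t)%:E)%E = (fine (I r))%:E.
  by rewrite -weightE -If.
rewrite dissipationE => eD.
exact: (fatou_decay mD' mrho (fun s t _ => rho0 s t) rho_nincr iE (drho s) eD).
Unshelve. all: by end_near. Qed.

End one_chart.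

End chart_integrals.

(** * Covering by chart domains *)

(** The ball is the union of the segments issuing from its centre, all of which share that point. *)
Lemma connected_ball (R : realType) (E : normedModType R) (x : E) (r : R) :
  0 < r -> connected (ball x r).
Proof.
move=> r0; pose seg (z : E) := (fun t : R => x + t *: (z - x)) @` `[0, 1].
have -> : ball x r = \bigcup_(z in ball x r) seg z.
  apply/seteqP; split=> [z zB|_ [z zB] [t t01 <-]].
    exists z => //; exists 1; first by rewrite /= in_itv/= ler01 lexx.
    by rewrite scale1r addrC subrK.
  move: t01 zB; rewrite /= in_itv/= -!ball_normE/= => /andP[t0 t1] zB.
  rewrite opprD addrA subrr sub0r normrN normrZ ger0_norm//.
  by rewrite (le_lt_trans _ zB)// distrC ler_piMl.
apply: bigcup_connected => [|z _].
  exists x => z _; exists 0; first by rewrite /= in_itv/= lexx ler01.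
  by rewrite scale0r addr0.
apply: connected_continuous_connected; first exact: segment_connected.
apply: continuous_subspaceT => t.
apply: cvgD; first exact: cvg_cst.
by apply: cvgZr_tmp; exact: cvg_id.
Qed.

Lemma compact_closed_ball (R : realType) n (x : 'rV[R]_n) (r : R) :
  0 < r -> compact (closed_ball x r).
Proof.
move=> r0; apply: bounded_closed_compact; last exact: closed_ball_closed.
rewrite closed_ballE//; exists (`|x| + r); split; first exact: num_real.
move=> m xm z; rewrite /closed_ball_ /= => xz.
rewrite (le_trans _ (ltW xm))//.
by rewrite -[z](subrK x) addrC (le_trans (ler_normD _ _))// lerD2l distrC.
Qed.

Section cover.
Context {R : realType} {n : nat} {Sigma : ptopologicalType}.
Variable M : smooth_manifold R n Sigma.

Definition chart_domain (D : set Sigma) : Prop :=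
  relatively_compact_domain D /\ exists c : chart M, D `<=` chart_dom c.

(** With half the radius of a ball inside the chart image, the closed ball still lies in that image;
    its image in [Sigma] is compact, hence closed in a Hausdorff space, and contains the closure of
    [D]. Taking a ball makes [D] connected. *)
Lemma chart_domain_nbhs (p : Sigma) : exists2 D, chart_domain D & D p.
Proof.
pose c := chart_at M p; have cp : chart_dom c p := mem_chart_at M p.
have /nbhs_ballP[r /= r0 rc] : nbhs (coord c p) (chart_img c).
  apply: open_nbhs_nbhs; split; first exact: chart_img_open.
  exact: mem_chart_img.
have r20 : 0 < r / 2 by rewrite divr_gt0.
have r2r : r / 2 < r by rewrite ltr_pdivrMr// ltr_pMr// ltr1n.
have Kc : closed_ball (coord c p) (r / 2) `<=` chart_img c.
  exact: subset_trans (closed_ball_subset r20 r2r) rc.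
have BK : ball (coord c p) (r / 2) `<=` closed_ball (coord c p) (r / 2).
  exact: subset_closure.
pose D := param c @` ball (coord c p) (r / 2).
have DE : D = chart_dom c `&` coord c @^-1` ball (coord c p) (r / 2).
  apply/seteqP; split=> [_ [y yB <-]|q [cq qB]].
    have [q cq yE] := Kc _ (BK _ yB).
    by rewrite -yE coordK//; split=> //=; rewrite yE.
  by exists (coord c q) => //; rewrite coordK.
exists D; last by exists (coord c p); [exact: ballxx|rewrite coordK].
split; last by exists c; rewrite DE => q [].
split.
- rewrite DE; apply: open_setI_preimage.
  + exact: chart_dom_open.
  + by move=> q; exact: coord_cts.
  + exact: ball_open.
- apply: connected_continuous_connected; first exact: connected_ball.
  apply: continuous_in_subspaceT => y /[!inE] yB.
  by apply: param_cts; exact: Kc (BK _ yB).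
- by exists p; exists (coord c p); [exact: ballxx|rewrite coordK].
- have KC : compact (param c @` closed_ball (coord c p) (r / 2)).
    apply: continuous_compact; last exact: compact_closed_ball.
    by apply: continuous_in_subspaceT => y /[!inE] yK; apply: param_cts; exact: Kc.
  rewrite precompactE; apply: (subclosed_compact _ KC); first exact: closed_closure.
  rewrite closureE => q; apply; split.
    by apply: compact_closed => //; exact: (manifold_hausdorff M).
  exact: image_subset.
Qed.

(** A Lindelof argument: countably many members of a base fit inside some chart domain, and they
    cover [Sigma]; one chart domain is chosen around each of them. *)
Lemma countable_chart_cover : exists D : nat -> set Sigma,
  (forall k, chart_domain (D k)) /\ forall p, exists k, D k p.
Proof.
have [B cB [oB bB]] := manifold_second_countable M.
pose good U := exists2 D, chart_domain D & U `<=` D.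
pose B' := B `&` good.
have /choice[f fP] : forall U, exists D, good U -> chart_domain D /\ U `<=` D.
  by move=> U; have [[D ? ?]|nU] := pselect (good U); [exists D|exists set0].
have B'p p : exists2 U, B' U & U p.
  have [D Dd Dp] := chart_domain_nbhs p.
  have [U [BU Up] UD] : filter_from [set U | B U /\ U p] id D.
    apply: bB; apply: open_nbhs_nbhs; split=> //; by have [[]] := Dd.
  by exists U => //; split=> //; exists D.
have cB' : countable B' by apply: sub_countable cB; apply: subset_card_le => U [].
(* A countable set is empty or the image of [nat]; the base point of [Sigma] excludes emptiness. *)
have /pfcard_geP[B'0|[e]] := cB'.
  by have [U] := B'p point; rewrite B'0.
exists (f \o e); split=> [k|p].
  have [_ /fP[]//] : B' (e k) by exact: funS.
have [U B'U Up] := B'p p.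
have [k _ kU] := @surj _ _ _ _ e U B'U.
by exists k; rewrite /= kU; have [_ /fP[_]] := B'U; exact.
Qed.

End cover.

Lemma compact_nat_cover (T : ptopologicalType) (K : set T) (D : nat -> set T) :
  compact K -> (forall k, open (D k)) -> (forall p, exists k, D k p) ->
  exists m, K `<=` \big[setU/set0]_(k < m) D k.
Proof.
rewrite compact_cover => cK oD cov.
have [//|p _|J _ KJ] := @cK nat setT D.
  by have [k Dk] := cov p; exists k.
exists (\max_(k <- finmap.enum_fset J) k).+1 => p /KJ[k /= kJ Dkp].
rewrite -bigcup_mkord; exists k => //=; rewrite ltnS.
exact: (@leq_bigmax_seq _ _ _ id).
Qed.

(** * Subadditivity over covers and the conclusion *)

Lemma continuous_measurable_g_sigma (R : realType) (T : ptopologicalType) (f : T -> R)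
    (D : set (g_sigma_algebraType (@open T))) :
  continuous f -> measurable D -> measurable_fun D (f : g_sigma_algebraType (@open T) -> R).
Proof.
move=> cf mD; apply: (@measurable_funS _ _ _ _ setT) => //.
by apply: (measurable_open_continuous (A := setT)) => // [|p _]; [exact: openT|exact: cf].
Qed.

Section integral_union.
Local Open Scope ereal_scope.
Context d (T : measurableType d) (R : realType) (mu : {measure set T -> \bar R}).
Variable f : T -> \bar R.
Hypothesis f0 : forall x, 0 <= f x.
Hypothesis mf : forall A, measurable A -> measurable_fun A f.

Lemma ge0_integral_setU_le (A B : set T) : measurable A -> measurable B ->
  \int[mu]_(x in A `|` B) f x <= \int[mu]_(x in A) f x + \int[mu]_(x in B) f x.
Proof.
move=> mA mB; have mBA : measurable (B `\` A) by exact: measurableD.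
have -> : A `|` B = A `|` (B `\` A) by rewrite setUDr setDv setD0.
rewrite ge0_integral_setU//.
- by rewrite leeD2l// ge0_subset_integral//; exact: mf.
- by apply: mf; exact: measurableU.
- by apply/disj_setPS => x [Ax []].
Qed.

Lemma ge0_integral_bigsetU_le (U : nat -> set T) m : (forall k, measurable (U k)) ->
  \int[mu]_(x in \big[setU/set0]_(k < m) U k) f x <=
  \sum_(k < m) \int[mu]_(x in U k) f x.
Proof.
move=> mU; elim: m => [|m IHm]; first by rewrite !big_ord0 integral_set0.
rewrite !big_ord_recr/=.
apply: le_trans (ge0_integral_setU_le _ _) _ => //; first exact: bigsetU_measurable.
by rewrite leeD2r.
Qed.

End integral_union.

Theorem theorem1p2 (R : realType) (n N : nat) (Sigma : ptopologicalType)
    (M : smooth_manifold R n Sigma) (V : 'rV[R]_N) (F : Sigma -> R -> 'rV[R]_N)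
    (mu : R -> {measure set (g_sigma_algebraType (@open Sigma)) -> \bar R})
    (F_smooth : smooth_family M F)
    (F_immersion : forall s, immersion M (F ^~ s))
    (F_complete : forall s, complete_induced_metric M (F ^~ s))
    (F_volume : forall s, is_volume_measure M (F ^~ s) (mu s))
    (F_flow : forall p s,
      derive1 (F p) s = mean_curvature M (F ^~ s) p + tangent_part M (F ^~ s) p V)
    (F_limits : forall D : set Sigma, relatively_compact_domain D ->
      exists Lminus Lplus : R,
        [/\ 0 < Lplus, Lplus <= Lminus,
            (\int[mu s]_(p in D) (expR (dot (F p s - s *: V) V))%:E)%E
              @[s --> +oo] --> Lplus%:E &
            (\int[mu s]_(p in D) (expR (dot (F p s - s *: V) V))%:E)%E
              @[s --> -oo] --> Lminus%:E]) :
  exists a b : nat -> R,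
    [/\ b @ \oo --> +oo, a @ \oo --> -oo &
        forall D : set Sigma, relatively_compact_domain D ->
          (\int[mu (b k)]_(p in D)
             (enorm (mean_curvature M (F ^~ (b k)) p
                     - normal_part M (F ^~ (b k)) p V) ^+ 2
              * expR (dot (F p (b k) - b k *: V) V))%:E)%E
            @[k --> \oo] --> 0%E /\
          (\int[mu (a k)]_(p in D)
             (enorm (mean_curvature M (F ^~ (a k)) p
                     - normal_part M (F ^~ (a k)) p V) ^+ 2
              * expR (dot (F p (a k) - a k *: V) V))%:E)%E
            @[k --> \oo] --> 0%E].
Proof.
have [U [Uchart Ucov]] := countable_chart_cover M.
pose J D s := (\int[mu s]_(p in D) (dissipation M V F s p)%:E)%E.
have Udecay m : exists ilh : (R -> R) * (R * R),
    [/\ {homo ilh.1 : x y / x <= y >-> y <= x},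
    forall s, ilh.2.1 <= ilh.1 s <= ilh.2.2 &
    forall s e, (e%:E < J (U m) s)%E ->
      exists2 r, 0 < r & forall h, 0 < h < r -> ilh.1 (s + h) <= ilh.1 s - e * h].
  have [Ud [c Uc]] := Uchart m; have [lm [lp [_ _ Ilp Ilm]]] := F_limits _ Ud.
  have oU : open (U m) by have [] := Ud.
  have [i [i1 i2 i3]] :=
    chart_decay F_smooth F_immersion F_volume F_flow oU Uc Ilp Ilm.
  by exists (i, (lp, lm)).
have {Udecay} [ilh Udecay] := choice Udecay.
have small k : exists2 T, 0 <= T & forall x : R, exists s, x <= s <= x + T /\
    forall m : 'I_k, (J (U m) s <= (k.+1%:R^-1)%:E)%E.
  apply: (@exists_small_rates R k (fun m => (ilh m).1) (fun m => J (U m))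
    (fun m => (ilh m).2.1) (fun m => (ilh m).2.2)).
  - by rewrite invr_gt0.
  - by move=> m; have [] := Udecay m.
  - by move=> m; have [] := Udecay m.
  - by move=> m s; have [_ _ h] := Udecay m; exact: h.
have /choice[b bP] (k : nat) : exists s : R, k%:R <= s /\
    forall m : 'I_k, (J (U m) s <= (k.+1%:R^-1)%:E)%E.
  have [T T0 /(_ k%:R)[s [/andP[ks _] sJ]]] := small k.
  by exists s.
have /choice[a aP] (k : nat) : exists s : R, s <= - k%:R /\
    forall m : 'I_k, (J (U m) s <= (k.+1%:R^-1)%:E)%E.
  have [T T0 /(_ (- k%:R - T))[s [/andP[_ ks] sJ]]] := small k.
  by exists s; rewrite subrK in ks.
have J0 D s : (0 <= J D s)%E.
  by apply: integral_ge0 => p _; rewrite lee_fin mulr_ge0 ?sqr_ge0 ?expR_ge0.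
have conv (s : nat -> R) D : relatively_compact_domain D ->
    (forall k (m : 'I_k), (J (U m) (s k) <= (k.+1%:R^-1)%:E)%E) ->
    J D (s k) @[k --> \oo] --> 0%E.
  move=> [oD _ _ pD] sP.
  have oU m : open (U m) by have [[]] := Uchart m.
  have cD : compact (closure D) by rewrite -precompactE.
  have [m0 m0P] := compact_nat_cover cD oU Ucov.
  have JD t : (J D t <= \sum_(m < m0) J (U m) t)%E.
    have mJ A : measurable (A : set (g_sigma_algebraType (@open Sigma))) ->
        measurable_fun A (EFin \o dissipation M V F t).
      move=> mA; apply/measurable_EFinP; apply: continuous_measurable_g_sigma => //.
      exact: continuous_dissipation.
    have mU m : measurable (U m : set (g_sigma_algebraType (@open Sigma))).
      by apply: sub_sigma_algebra; exact: oU.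
    have f0 p : (0 <= (dissipation M V F t p)%:E)%E.
      by rewrite lee_fin mulr_ge0 ?sqr_ge0 ?expR_ge0.
    apply: (@le_trans _ _ (\int[mu t]_(p in \big[setU/set0]_(k < m0) U k)
        (dissipation M V F t p)%:E)%E); last exact: ge0_integral_bigsetU_le.
    apply: ge0_subset_integral => //.
    - exact: sub_sigma_algebra.
    - exact: bigsetU_measurable.
    - by apply: mJ; exact: bigsetU_measurable.
    - by move=> p Dp; apply: m0P; exact: subset_closure.
  apply: (@squeeze_cvge _ _ _ _ (cst 0%E) _ (fun k => (m0%:R * k.+1%:R^-1)%:E)).
  - near=> k; rewrite J0/=; apply: (le_trans (JD _)).
    have km : (m0 <= k)%N by near: k; exists m0.
    rewrite (@le_trans _ _ (\sum_(m < m0) (k.+1%:R^-1)%:E)%E)//.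
      apply: lee_sum => m _; have := sP k (widen_ord km m); exact.
    by rewrite sumEFin sumr_const card_ord mulr_natl.
  - exact: cvg_cst.
  - apply: cvg_EFin; first by near=> k.
    rewrite -[X in _ --> X](mulr0 m0%:R); apply: cvgMl_tmp.
    exact: cvg_harmonic.
exists a, b; split.
- apply/cvgryPge => A; near=> k; have [kb _] := bP k; apply: le_trans kb.
  near: k; exact: nbhs_infty_ger.
- apply/cvgrNyPle => A; near=> k; have [ka _] := aP k; apply: (le_trans ka).
  rewrite lerNl; near: k; exact: nbhs_infty_ger.
- by move=> D Dd; split; apply: conv => // k m; [have [_] := bP k|have [_] := aP k].
Unshelve. all: by end_near. Qed.
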